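(* Let $k\geq1$. There are constants $C,c>0$ depending only on $k$ and $q$ such that the following holds. Let $B$ be a Bohr set and let $A,L,S_1,\dots,S_k\subset B$ be nonempty, with densities $\alpha=\beta(A)$, $\lambda=\beta(L)$, $\sigma_i=\beta(S_i)$, where $\alpha<e^{-2}$. Then either (1) $\langle L\ast S_1\ast\cdots\ast S_k,A\rangle_\beta\geq\lambda\sigma_1\cdots\sigma_k\alpha/2$; or (2) for every positive integer $l$ there exists a Bohr set $B'\subset B$ with \[\mathrm{rk}(B')\leq\mathrm{rk}(B)+C\lambda^{-2-1/l}\alpha^{-1/l}l^2\log(1/\alpha)\log(1/\sigma_k),\] \[\beta(B')\geq\exp\big(-C\lambda^{-2-1/l}\alpha^{-1/l}l^2\log(1/\alpha)\log(1/\sigma_k)\big),\] and, for some $x\in B$, $\beta'(A+x)\geq\alpha(1+c\lambda)$.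
   Context: Let $q$ be a prime power, $N$ a positive integer, and $G=G_N$ the set of polynomials in $\mathbb{F}_q[t]$ of degree $<N$. For $x=\sum_{i<M}a_it^i\in\mathbb{F}_q((1/t))$ write $\{x\}=\sum_{i<0}a_it^i$; let $\mathbb{T}=\{\sum_{i<0}a_it^i\}$. For finite $\Gamma\subset\mathbb{T}$ and $\kappa:\Gamma\to\mathbb{N}$, the Bohr set $B_\kappa(\Gamma)=\{x\in G:\deg\{x\xi\}<-\kappa(\xi)\ \forall\xi\in\Gamma\}$ has rank $|\Gamma|$ (it is an $\mathbb{F}_q$-subspace of $G$). Sets are identified with indicator functions. For a Bohr set $B$, $\beta(X)=|X\cap B|/|B|$; for a Bohr set $B'$, $\beta'(X)=|X\cap B'|/|B'|$. Convolution is taken over $B$: $f\ast g(x)=\mathbb{E}_{y\in B}f(y)g(x-y)$ for $x\in G$. The inner product is $\langle f,g\rangle_\beta=\mathbb{E}_{x\in B}f(x)\overline{g(x)}$. *)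

(* Defs.v *)
From HB Require Import structures.
From mathcomp Require Import all_boot all_order all_algebra finmap.
From mathcomp Require Import boolp reals.

Set Implicit Arguments.
Unset Strict Implicit.
Unset Printing Implicit Defensive.

Import Order.TTheory GRing.Theory Num.Theory.
Local Open Scope ring_scope.

Section Laurent.
Variable F : finFieldType.

(* A formal Laurent series sum_i a_i t^i of F((1/t)) is represented by its
   coefficient function a : int -> F, which vanishes at all large indices.
   The classical choiceType structure on functions makes {fset (int -> F)}
   available. *)
Implicit Types (a : int -> F) (x : {poly F}).

Definition in_torus a : Prop := forall i : int, 0 <= i -> a i = 0.

Definition laurent_mul x a : int -> F :=
  fun n => \sum_(i < size x) x`_i * a (n - i%:Z).

Definition frac_part a : int -> F := fun n => if n < 0 then a n else 0.

(* deg a < m, with deg 0 = -oo *)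
Definition deg_lt a (m : int) : Prop := forall i : int, m <= i -> a i = 0.

End Laurent.

(* The rank of a Bohr set depends on the frequencies that present it, so a Bohr
   set is carried as its presentation (Gamma, kappa). *)
Record bohr (F : finFieldType) := Bohr {
  freqs : {fset (int -> F)};
  freqs_torus : forall xi, xi \in freqs -> in_torus xi;
  width : freqs -> nat
}.

Section Bohr.
Variables (F : finFieldType) (N : nat).

(* {poly_N F} is the type of polynomials of size at most N, i.e. degree < N. *)
Definition bohr_set (B : bohr F) : {set {poly_N F}} :=
  [set x : {poly_N F} | `[< forall xi : freqs B,
     deg_lt (frac_part (laurent_mul (val x) (val xi))) (- (width xi)%:Z) >]].

Definition rk (B : bohr F) : nat := #|` freqs B|.

End Bohr.

Section Averages.
Variables (R : realType) (F : finFieldType) (N : nat).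
Implicit Types (B X : {set {poly_N F}}) (f g : {poly_N F} -> R).

Definition density B X : R := #|X :&: B|%:R / #|B|%:R.

Definition indicator X : {poly_N F} -> R := fun x => (x \in X)%:R.

Definition expect B f : R := (\sum_(x in B) f x) / #|B|%:R.

Definition conv B f g : {poly_N F} -> R :=
  fun x => expect B (fun y => f y * g (x - y)).

(* Only real-valued functions occur, so no conjugation is needed. *)
Definition inner B f g : R := expect B (fun x => f x * g x).

(* L * S_1 * ... * S_k, associated to the left *)
Definition iter_conv B (L : {set {poly_N F}}) (S : nat -> {set {poly_N F}})
    (k : nat) : {poly_N F} -> R :=
  foldl (fun f i => conv B f (indicator (S i))) (indicator L) (iota 1 k).

Definition translate X (x : {poly_N F}) : {set {poly_N F}} :=
  [set a + x | a in X].

End Averages.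

(* Main.v *)
Require Import Defs.
From HB Require Import structures.
From mathcomp Require Import all_boot all_order all_algebra finmap.
From mathcomp Require Import boolp reals sequences exp.
From mathcomp Require Import ring lra zify.

Import Order.TTheory GRing.Theory Num.Theory.
Local Open Scope ring_scope.

(** Averaging over S_1, ..., S_(k-1) reduces to one set: if (1) fails, some
    translate of A satisfies <L * S_k, A> < lambda sigma_k alpha / 2.

    Sample n ~ l^2 lambda^-2 log(1/alpha) points of S_k at random (Croot-Sisask).
    An exponential moment bound for the sampling error, combined with Jensen's
    inequality over A, produces a set T of density at least sigma_k^n / 2 by whose
    elements y |-> E_(a in A) (L * mu_(S_k)) (a + y) is translated with uniform
    error lambda / (4 l).  Smoothing l times by T therefore changes the inner
    product by a small multiple of lambda only.

    Let U annihilate the functionals at which T has bias greater than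
    eta = (lambda alpha / 128)^(1 / 2l).  Away from U-invariant functions,
    smoothing by T contracts the L^2 norm by eta, so after l steps averaging over
    U costs little.  Hence A must have increased density on a coset of U.  By
    Chang's theorem U has codimension O(eta^-2 log(1 / |T|)), and each functional
    that cuts it out is the coefficient of t^-1 in x xi for some frequency xi. *)

(** * Exponential and quadratic inequalities for finite sums *)

Section FiniteInequalities.
Context {R : realType}.

(** The bound [expR x <= (1 - x)^-1] suffices, as (1 + x + 2x^2)(1 - x) = 1 + x^2 (1 - 2x) is at
    least 1 here. *)
Lemma expR_le_quadratic (x : R) : x <= 2^-1 -> expR x <= 1 + x + 2 * x ^+ 2.
Proof.
move=> xle.
have x1 : 0 < 1 - x by lra.
have h : expR x <= (1 - x)^-1.
  rewrite -[expR x]invrK -expRN lef_pV2 ?posrE ?expR_gt0 //.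
  exact: le_trans (expR_ge1Dx _).
apply: le_trans h _; rewrite -div1r ler_pdivrMr //; nra.
Qed.

(** Jensen's inequality: the exponential lies above its tangent at the mean [m], and the weighted
    sum of the tangent values is [expR m]. *)
Lemma expR_convex (I : finType) (P : pred I) (w y : I -> R) :
  (forall i, P i -> 0 <= w i) -> \sum_(i | P i) w i = 1 ->
  expR (\sum_(i | P i) w i * y i) <= \sum_(i | P i) w i * expR (y i).
Proof.
move=> w0 w1; set m := \sum_(i | P i) w i * y i.
have -> : expR m = \sum_(i | P i) w i * (expR m * (1 + y i - m)).
  rewrite (eq_bigr (fun i => expR m * (1 - m) * w i + expR m * (w i * y i))).
    by rewrite big_split /= -!mulr_sumr w1 -/m; ring.
  by move=> i _; ring.
apply: ler_sum => i Pi; apply: ler_wpM2l; first exact: w0.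
rewrite -[y i in X in _ <= X](subrKC m) expRD ler_pM2l ?expR_gt0 //.
by apply: le_trans (expR_ge1Dx _); rewrite addrA.
Qed.

(** Weighted Cauchy-Schwarz: once symmetrised, the difference is the sum of w_i w_j (y_i - y_j)^2 /
    2. *)
Lemma sqr_weighted_sum (I : finType) (w y : I -> R) :
  (forall i, 0 <= w i) ->
  (\sum_i w i * y i) ^+ 2 <= (\sum_i w i) * \sum_i w i * y i ^+ 2.
Proof.
move=> w0; rewrite expr2 !big_distrlr /=.
pose f (i j : I) : R := w i * (w j * y j ^+ 2).
have -> : \sum_i \sum_j w i * (w j * y j ^+ 2)
    = \sum_i \sum_j (f i j + f j i) / 2.
  under [RHS]eq_bigr do rewrite -mulr_suml big_split /=.
  rewrite -mulr_suml big_split /= [X in _ + X]exchange_big /= /f.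
  by set s := \sum_i _; field.
apply: ler_sum => i _; apply: ler_sum => j _; rewrite /f.
have := mulr_ge0 (mulr_ge0 (w0 i) (w0 j)) (sqr_ge0 (y i - y j)); nra.
Qed.

(** The linear terms of the quadratic bound cancel because [y] sums to zero. *)
Lemma mgf_bound (I : finType) (P : pred I) (y : I -> R) (K u : R) :
  (forall i, P i -> `|y i| <= K) -> `|u| * K <= 2^-1 ->
  \sum_(i | P i) y i = 0 ->
  \sum_(i | P i) expR (u * y i) <= #|P|%:R * expR (2 * (u * K) ^+ 2).
Proof.
move=> yK uK y0.
have h i : P i -> expR (u * y i) <= 1 + 2 * (u * K) ^+ 2 + u * y i.
  move=> Pi; have := yK i Pi; have := ler_wpM2l (normr_ge0 u) (yK i Pi).
  rewrite -normrM => h1 h2.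
  have := @expR_le_quadratic (u * y i) (le_trans (ler_norm _) (le_trans h1 uK)).
  have : (u * y i) ^+ 2 <= (u * K) ^+ 2.
    rewrite -[X in X <= _]real_normK ?num_real //.
    rewrite [X in _ <= X]exprMn -[u ^+ 2]real_normK ?num_real // -exprMn.
    by rewrite ler_sqr ?nnegrE // ?mulr_ge0 // (le_trans _ h2).
  lra.
apply: le_trans (ler_sum _ h) _.
rewrite big_split /= -mulr_sumr y0 mulr0 addr0 sumr_const -[X in X <= _]mulr_natl.
by rewrite ler_wpM2l // expR_ge1Dx.
Qed.

End FiniteInequalities.

(** * Averages over finite sets *)

Section Average.
Context {R : realType} {T : finType}.
Implicit Types (X : {set T}) (f g : T -> R).

Definition average X f : R := (\sum_(x in X) f x) / #|X|%:R.

Lemma card_gt0R X : X != set0 -> (0 : R) < #|X|%:R.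
Proof. by move=> X0; rewrite ltr0n card_gt0. Qed.

Lemma eq_average X f g : {in X, f =1 g} -> average X f = average X g.
Proof. by move=> fg; rewrite /average; congr (_ / _); apply: eq_bigr. Qed.

Lemma average_const X (c : R) : X != set0 -> average X (fun=> c) = c.
Proof.
move=> /card_gt0R X0.
by rewrite /average sumr_const -[c *+ _]mulr_natr mulfK // gt_eqF.
Qed.

Lemma averageD X f g :
  average X (fun x => f x + g x) = average X f + average X g.
Proof. by rewrite /average big_split mulrDl. Qed.

Lemma averageB X f g :
  average X (fun x => f x - g x) = average X f - average X g.
Proof. by rewrite /average sumrB mulrBl. Qed.

Lemma averageZ X (c : R) f : average X (fun x => c * f x) = c * average X f.
Proof. by rewrite /average -mulr_sumr mulrA. Qed.

Lemma ler_average X f g : {in X, forall x, f x <= g x} ->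
  average X f <= average X g.
Proof. by move=> fg; rewrite ler_wpM2r ?invr_ge0 ?ler0n // ler_sum. Qed.

Lemma average_ge0 X f : {in X, forall x, 0 <= f x} -> 0 <= average X f.
Proof. by move=> f0; rewrite divr_ge0 ?ler0n ?sumr_ge0. Qed.

Lemma average_le X f (c : R) : X != set0 -> {in X, forall x, f x <= c} ->
  average X f <= c.
Proof. by move=> X0 fc; rewrite -[leRHS](average_const X c) // ler_average. Qed.

Lemma normr_average X f : `|average X f| <= average X (fun x => `|f x|).
Proof.
rewrite /average normrM [X in _ * X]ger0_norm ?invr_ge0 ?ler0n //.
by rewrite ler_wpM2r ?invr_ge0 ?ler0n // ler_norm_sum.
Qed.

Lemma expR_average X f : X != set0 ->
  expR (average X f) <= average X (fun x => expR (f x)).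
Proof.
move=> X0; rewrite /average !mulr_suml.
under eq_bigr do rewrite mulrC.
under [leRHS]eq_bigr do rewrite mulrC.
apply: expR_convex => [i _|]; first by rewrite invr_ge0 ler0n.
by rewrite sumr_const -[X in X = _]mulr_natl divff // gt_eqF // card_gt0R.
Qed.

End Average.

Lemma exchange_average {R : realType} (T T' : finType) (X : {set T})
    (Y : {set T'}) (f : T -> T' -> R) :
  average X (fun x => average Y (f x))
  = average Y (fun y => average X (fun x => f x y)).
Proof.
rewrite /average; under eq_bigr do rewrite mulr_suml.
under [in RHS]eq_bigr do rewrite mulr_suml.
rewrite !mulr_suml; under eq_bigr do rewrite mulr_suml.
under [in RHS]eq_bigr do rewrite mulr_suml.
rewrite exchange_big; apply: eq_bigr => y _; apply: eq_bigr => x _.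
exact: mulrAC.
Qed.


(** * Almost-periods by random sampling (Croot-Sisask) *)

Section AlmostPeriods.
Context {R : realType} {V : finZmodType}.
Variables (f : V -> R) (A S : {set V}) (n : nat) (e : R).
Hypothesis f01 : forall x, 0 <= f x <= 1.
Hypothesis A0 : A != set0.
Hypothesis S0 : S != set0.
Hypothesis n0 : (0 < n)%N.
Hypothesis e01 : 0 < e <= 1.
Hypothesis ne : 4 * #|V|%:R / #|A|%:R <= expR (n%:R * e ^+ 2 / 8).

Let e_gt0 : 0 < e. Proof. by case/andP: e01. Qed.
Let e_le1 : e <= 1. Proof. by case/andP: e01. Qed.
Let F x := average S (fun s => f (x - s)).
Let H y := average A (fun a => F (a + y)).

(** The coordinates of a sample are independent, so the sum factors as an [n]-th power. *)
Lemma sampling_mgf (x : V) (u : R) : `|u| <= 2^-1 ->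
  \sum_(z in ffun_on (mem S)) expR (u * \sum_(i < n) (f (x - z i) - F x))
  <= #|S|%:R ^+ n * expR (2 * n%:R * u ^+ 2).
Proof.
move=> u1.
have -> : \sum_(z in ffun_on (mem S)) expR (u * \sum_(i < n) (f (x - z i) - F x))
   = (\sum_(s in S) expR (u * (f (x - s) - F x))) ^+ n.
  transitivity (\prod_(i < n) \sum_(s in S) expR (u * (f (x - s) - F x))).
    rewrite bigA_distr_big /=; apply: eq_bigr => z _.
    by rewrite mulr_sumr expR_sum.
  by rewrite prodr_const card_ord.
have F01 : 0 <= F x <= 1.
  apply/andP; split; first by apply: average_ge0 => s _; case/andP: (f01 (x - s)).
  by apply: average_le => // s _; case/andP: (f01 (x - s)).
have := @mgf_bound R V (mem S) (fun s => f (x - s) - F x) 1 u.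
rewrite !mulr1 => h.
have -> : expR (2 * n%:R * u ^+ 2) = expR (2 * u ^+ 2) ^+ n.
  by rewrite -expRM_natl; congr expR; ring.
rewrite -exprMn lerXn2r ?nnegrE ?sumr_ge0 ?mulr_ge0 ?ler0n ?expR_ge0 //.
  by move=> s _; rewrite expR_ge0.
rewrite (le_trans (h _ _ _)) //.
- by move=> s _; have := f01 (x - s); rewrite ler_norml; lra.
- rewrite sumrB sumr_const -mulr_natl /F /average mulrCA divff.
    by rewrite mulr1 subrr.
  by rewrite gt_eqF // card_gt0R.
Qed.

(** The two signs control the sampling error from both sides; summing over all [x] lets one sample
    serve every translate of [A]. *)
Let G (z : {ffun 'I_n -> V}) : R := \sum_x
  (expR (e / 4 * \sum_(i < n) (f (x - z i) - F x))
   + expR (- (e / 4) * \sum_(i < n) (f (x - z i) - F x))).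
Let K : R := 4 * #|V|%:R * expR (2 * n%:R * (e / 4) ^+ 2).
Let good : {set {ffun 'I_n -> V}} := [set z in ffun_on (mem S) | G z <= K].

Let V_gt0 : (0 : R) < #|V|%:R.
Proof. by rewrite ltr0n; apply/card_gt0P; exists 0. Qed.

(** Markov's inequality: [K] is twice the bound that [sampling_mgf] gives for the mean of [G]. *)
Lemma card_good_samples : #|S|%:R ^+ n / 2 <= #|good|%:R :> R.
Proof.
have u1 : `|e / 4| <= 2^-1 by have e0 := e_gt0; have e1 := e_le1; rewrite ger0_norm; lra.
have K0 : 0 < K by rewrite !mulr_gt0 ?expR_gt0.
have G0 z : 0 <= G z by rewrite sumr_ge0 // => x _; rewrite addr_ge0 ?expR_ge0.
have tot : \sum_(z in ffun_on (mem S)) G z <= K * #|S|%:R ^+ n / 2.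
  rewrite exchange_big /=.
  apply: (@le_trans _ _ (\sum_(x : V)
      2 * (#|S|%:R ^+ n * expR (2 * n%:R * (e / 4) ^+ 2)))).
    apply: ler_sum => x _; rewrite big_split /= mulr2n mulrDl !mul1r lerD //.
      exact: sampling_mgf.
    by rewrite -(sqrrN (e / 4)) sampling_mgf // normrN.
  rewrite sumr_const -[leLHS]mulr_natr /K.
  by rewrite le_eqVlt; apply/orP; left; apply/eqP; field.
have split_card : #|S|%:R ^+ n = #|good|%:R
    + \sum_(z in ffun_on (mem S) | ~~ (G z <= K)) (1 : R).
  rewrite -natrX -[n in LHS]card_ord -card_ffun_on -sumr_const.
  rewrite (bigID (fun z => G z <= K)) /= sumr_const; congr (_%:R + _).
  by apply: eq_card => z; rewrite !inE.
have bad : K * \sum_(z in ffun_on (mem S) | ~~ (G z <= K)) 1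
    <= K * #|S|%:R ^+ n / 2.
  rewrite mulr_sumr; apply: le_trans tot.
  rewrite [leRHS](bigID (fun z => G z <= K)) /= -[leLHS]add0r lerD ?sumr_ge0 //.
  by apply: ler_sum => z /andP[_]; rewrite -ltNge mulr1 => /ltW.
by move: bad; rewrite -mulrA ler_pM2l //; lra.
Qed.

(** Jensen bounds the exponential of the average over [A] by an average of exponentials. Extending
    that sum from a translate of [A] to the whole group costs only the factor [#|V| / #|A|],
    uniformly in [y]. *)
Lemma good_sample_close z y : z \in good ->
  `|average A (fun a => (\sum_(i < n) f (a + y - z i)) / n%:R) - H y| <= e.
Proof.
rewrite inE => /andP[_ GK].
have nR : (0 : R) < n%:R by rewrite ltr0n.
have AR : (0 : R) < #|A|%:R by rewrite card_gt0R.
rewrite /H -averageB.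
set D := fun a : V => _ - _.
pose X x : R := \sum_(i < n) (f (x - z i) - F x).
have DX a : D a = X (a + y) / n%:R.
  by rewrite /D /X sumrB sumr_const card_ord -mulr_natr; field; rewrite gt_eqF.
have key (w : R) :
    \sum_x expR (w * X x) <= G z -> w * n%:R * average A D <= n%:R * e ^+ 2 / 4.
  move=> le_w; rewrite -ler_expR.
  have -> : w * n%:R * average A D = average A (fun a => w * X (a + y)).
    rewrite -averageZ; apply: eq_average => a _.
    by rewrite DX; field; rewrite gt_eqF.
  apply: le_trans (expR_average _ _ A0) _.
  rewrite /average ler_pdivrMr //.
  have shift : \sum_(a in A) expR (w * X (a + y)) <= \sum_x expR (w * X x).
    rewrite [leRHS](reindex_inj (addIr y)) /=.
    rewrite [leRHS](bigID (mem A)) /= lerDl sumr_ge0 // => ? _.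
    exact: expR_ge0.
  apply: le_trans shift (le_trans le_w (le_trans GK _)).
  (* The first summand pays for [4 * #|V| / #|A|] through [ne]; the second is the exponent in
     [K]. *)
  have -> : n%:R * e ^+ 2 / 4 = n%:R * e ^+ 2 / 8 + 2 * n%:R * (e / 4) ^+ 2 by field.
  rewrite expRD mulrAC /K ler_pM2r ?expR_gt0 //.
  by rewrite -ler_pdivrMr.
have e4 : 0 < e / 4 * n%:R by have e0 := e_gt0; rewrite mulr_gt0 //; lra.
have Gle (w : R) : (w = e / 4) \/ (w = - (e / 4)) -> \sum_x expR (w * X x) <= G z.
  rewrite /G; case=> ->; apply: ler_sum => x _; rewrite -/(X x);
    have := expR_ge0 (e / 4 * X x); have := expR_ge0 (- (e / 4) * X x); lra.
have k1 := key _ (Gle _ (or_introl erefl)).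
have k2 := key _ (Gle _ (or_intror erefl)).
have E : n%:R * e ^+ 2 / 4 = e / 4 * n%:R * e by field.
rewrite E in k1 k2.
rewrite ler_norml; apply/andP; split.
  by rewrite lerNl -(ler_pM2l e4) (le_trans _ k2) // mulrN !mulNr.
by rewrite -(ler_pM2l e4).
Qed.

(** If the translates of one sample [z] by [t0] and by [t] are both good, then [t - t0] is an
    almost-period. Double counting supplies a [z] with many good translates. *)
Lemma almost_periods_density :
  (#|S|%:R / #|V|%:R) ^+ n / 2
   <= #|[set t | [forall y, `|H (y + t) - H y| <= 2 * e]]|%:R / #|V|%:R
  :> R.
Proof.
set T := [set t | _].
pose shift (z : {ffun 'I_n -> V}) t := [ffun i => z i + t].
(* Translation by a fixed [t] permutes the samples, so there are exactly [#|V| * #|good|] pairs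
   [(z, t)] with a good translate. *)
have [z le_z] : exists z, #|V|%:R * #|good|%:R / #|V|%:R ^+ n
    <= #|[set t | shift z t \in good]|%:R :> R.
  apply/existsP; apply: contraT; rewrite negb_exists => /forallP h.
  have : \sum_(z : {ffun 'I_n -> V}) #|[set t | shift z t \in good]|%:R
      < \sum_(z : {ffun 'I_n -> V}) #|V|%:R * #|good|%:R / #|V|%:R ^+ n :> R.
    apply: ltr_sum => [|z _]; last by rewrite ltNge.
    by apply/hasP; exists [ffun=> 0]; rewrite ?mem_index_enum.
  rewrite sumr_const card_ffun card_ord -[ltRHS]mulr_natr natrX divfK; last first.
    by rewrite expf_neq0 // gt_eqF.
  under eq_bigr do rewrite -sum1_card natr_sum big_mkcond /=.
  rewrite exchange_big /=.
  rewrite (eq_bigr (fun=> #|good|%:R)); last first.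
    move=> t _; pose unshift (z : {ffun 'I_n -> V}) := shift z (- t).
    have unshift_inj : injective unshift.
      move=> z z' /ffunP E; apply/ffunP => i; have := E i.
      by rewrite !ffunE => /addIr.
    rewrite (reindex_inj unshift_inj) /= -sum1_card natr_sum [RHS]big_mkcond.
    apply: eq_bigr => z _; rewrite inE (_ : shift (unshift z) t = z) //.
    by apply/ffunP => i; rewrite !ffunE addrNK.
  by rewrite sumr_const -[ltLHS]mulr_natl ltxx.
set Z := [set t | _] in le_z.
have VR := V_gt0.
have T_ge : (#|S|%:R / #|V|%:R) ^+ n / 2 <= #|Z|%:R / #|V|%:R :> R.
  rewrite ler_pdivlMr //; apply: le_trans le_z.
  have := card_good_samples; set g := #|good|%:R => hg.
  rewrite expr_div_n.
  have : 0 < (#|V|%:R ^+ n : R)^-1 by rewrite invr_gt0 exprn_gt0.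
  set iv := _^-1 => iv0.
  rewrite [leLHS](_ : _ = #|V|%:R * (#|S|%:R ^+ n / 2) * iv); last by ring.
  by rewrite ler_pM2r // ler_pM2l.
apply: le_trans T_ge _; rewrite ler_pM2r ?invr_gt0 // ler_nat.
case: (set_0Vmem Z) => [->|[t0 t0Z]]; first by rewrite cards0.
rewrite -(card_imset (mem Z) (addIr (- t0))) subset_leq_card //.
apply/subsetP => _ /imsetP[t tZ ->]; rewrite inE; apply/forallP => y.
move: t0Z tZ; rewrite ![_ \in Z]inE => h0 h1.
pose Q y := average A (fun a => (\sum_(i < n) f (a + y - z i)) / n%:R).
have QE t' y' : average A (fun a => (\sum_(i < n) f (a + y' - shift z t' i)) / n%:R)
    = Q (y' - t').
  apply: eq_average => a _; congr (_ / _); apply: eq_bigr => i _.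
  by rewrite ffunE opprD [- z i - t']addrC !addrA.
(* Both values of [H] are compared with the same sampled average [Q (y - t0)]. *)
have := good_sample_close _ y h0; rewrite QE.
have := good_sample_close _ (y - t0 + t) h1; rewrite QE addrK addrA.
rewrite [y + t - t0]addrAC => a1 a0.
rewrite (_ : _ - _ = (Q (y - t0) - H y) - (Q (y - t0) - H (y - t0 + t))); last by ring.
by apply: le_trans (ler_normB _ _) _; lra.
Qed.

End AlmostPeriods.

(** * Smoothing by averages over translates *)

Section Smoothing.
Context {R : realType} {V : finZmodType}.
Implicit Types (X Y T : {set V}) (f g : V -> R).

Definition smooth X f : V -> R := fun x => average X (fun t => f (x + t)).

Lemma smoothC X Y f : smooth X (smooth Y f) = smooth Y (smooth X f).
Proof.
apply/funext => x; rewrite /smooth exchange_average.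
apply: eq_average => y _; apply: eq_average => t _.
by rewrite addrAC.
Qed.

Lemma iter_smoothC X Y m f :
  iter m (smooth X) (smooth Y f) = smooth Y (iter m (smooth X) f).
Proof. by elim: m => //= m ->; rewrite smoothC. Qed.

Lemma smoothB X f g :
  smooth X (fun x => f x - g x) = (fun x => smooth X f x - smooth X g x).
Proof. by apply/funext => x; rewrite /smooth averageB. Qed.

Lemma sum_smooth X f : X != set0 -> \sum_x smooth X f x = \sum_x f x.
Proof.
move=> X0; rewrite /smooth /average -mulr_suml exchange_big /=.
rewrite (eq_bigr (fun=> \sum_x f x)); last first.
  by move=> t _; rewrite [RHS](reindex_inj (addIr t)).
by rewrite sumr_const -[_ *+ #|X|]mulr_natr mulfK // gt_eqF // card_gt0R.
Qed.

Lemma sum_iter_smooth X m f : X != set0 ->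
  \sum_x iter m (smooth X) f x = \sum_x f x.
Proof. by move=> X0; elim: m => //= m <-; rewrite sum_smooth. Qed.

Lemma smooth_itv01 X f : X != set0 -> (forall x, 0 <= f x <= 1) ->
  forall x, 0 <= smooth X f x <= 1.
Proof.
move=> X0 f01 x; apply/andP; split.
  by apply: average_ge0 => t _; case/andP: (f01 (x + t)).
by apply: average_le => // t _; case/andP: (f01 (x + t)).
Qed.

Lemma iter_smooth_itv01 X m f : X != set0 -> (forall x, 0 <= f x <= 1) ->
  forall x, 0 <= iter m (smooth X) f x <= 1.
Proof. by move=> X0 f01; elim: m => //= m IH; exact: smooth_itv01. Qed.

(** Smoothing does not increase the sup norm, so each further step adds at most [d]. *)
Lemma iter_smooth_close X m f (d : R) : X != set0 ->
  (forall x, {in X, forall t, `|f (x + t) - f x| <= d}) ->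
  forall x, `|iter m (smooth X) f x - f x| <= m%:R * d.
Proof.
move=> X0 fd; have close x : `|smooth X f x - f x| <= d.
  rewrite -[f x](average_const X) // /smooth -averageB.
  apply: le_trans (normr_average _ _) _; exact: average_le.
elim: m => [|m IH] x /=; first by rewrite subrr normr0 mul0r.
have -> : smooth X (iter m (smooth X) f) x - f x
    = smooth X (fun y => iter m (smooth X) f y - f y) x + (smooth X f x - f x).
  by rewrite smoothB; ring.
apply: le_trans (ler_normD _ _) _.
rewrite -natr1 mulrDl mul1r lerD //.
apply: le_trans (normr_average _ _) _; exact: average_le.
Qed.

End Smoothing.

Lemma sumr_cst {R : realType} (I : finType) (c : R) :
  \sum_(i : I) c = c * #|I|%:R.
Proof. by rewrite sumr_const -[LHS]mulr_natr. Qed.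

(** * Fibres of surjective linear maps *)

Section LinearFibers.
Context {R : realType} {F : finFieldType} {n r : nat}.
Variable Phi : 'M[F]_(r, n).
Hypothesis Phi_free : row_free Phi.

Definition annihilator {r' : nat} (M : 'M[F]_(r', n)) : {set 'rV[F]_n} :=
  [set x | x *m M^T == 0].

(** A right inverse [Psi] of [Phi] gives a point in each fibre, which is thus a translate of the
    annihilator. *)
Lemma card_linear_fiber (z : 'rV[F]_r) :
  #|[pred x : 'rV[F]_n | x *m Phi^T == z]| = #|annihilator Phi|.
Proof.
have [Psi PhiPsi] := row_freeP Phi_free.
have h : z *m Psi^T *m Phi^T = z.
  by rewrite -mulmxA -trmx_mul PhiPsi trmx1 mulmx1.
rewrite -(card_imset (mem (annihilator Phi)) (addIr (z *m Psi^T))).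
apply: eq_card => x; rewrite inE; apply/eqP/imsetP.
  move=> <-; exists (x - x *m Phi^T *m Psi^T); last by rewrite addrNK.
  rewrite inE mulmxBl -[X in _ - X == _]mulmxA -trmx_mul PhiPsi trmx1 mulmx1.
  by rewrite subrr.
by case=> y; rewrite inE => /eqP y0 ->; rewrite mulmxDl y0 add0r.
Qed.

Lemma sum_linear_fiber (g : 'rV[F]_r -> R) :
  \sum_(x : 'rV[F]_n) g (x *m Phi^T)
  = #|annihilator Phi|%:R * \sum_(z : 'rV[F]_r) g z.
Proof.
rewrite (partition_big (fun x : 'rV[F]_n => x *m Phi^T) predT) //= mulr_sumr.
apply: eq_bigr => z _.
rewrite (eq_bigr (fun=> g z)) => [|x /eqP -> //].
by rewrite sumr_const card_linear_fiber mulr_natl.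
Qed.

Lemma card_annihilator :
  #|'rV[F]_n|%:R = #|annihilator Phi|%:R * #|F|%:R ^+ r :> R.
Proof.
have := sum_linear_fiber (fun=> 1).
by rewrite !sumr_const (card_mx _ 1 r) mul1n natrX.
Qed.

End LinearFibers.

(** * Fourier analysis through fibre sums, and Chang's theorem *)

Section Fourier.
Context {R : realType} {F : finFieldType} {n : nat}.
Local Notation V := 'rV[F]_n.
Local Notation q := (#|F|%:R : R).
Implicit Types (f g : V -> R) (phi x : V) (T U : {set V}) (a b : F).

Definition dot x phi : F := (x *m phi^T) 0 0.

Lemma dotDl x y phi : dot (x + y) phi = dot x phi + dot y phi.
Proof. by rewrite /dot mulmxDl mxE. Qed.

Lemma dotBl x y phi : dot (x - y) phi = dot x phi - dot y phi.
Proof. by rewrite /dot mulmxBl !mxE. Qed.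

Lemma dotC x phi : dot x phi = dot phi x.
Proof. by rewrite /dot -[in RHS](trmxK phi) -trmx_mul [RHS]mxE. Qed.

Lemma q_gt1 : 1 < q.
Proof. by rewrite ltr1n card_finNzRing_gt1. Qed.

Let q_gt0 : 0 < q. Proof. by apply: lt_trans q_gt1. Qed.

(* [fiber_sum f phi] records the Fourier coefficients of [f] at all the
   frequencies on the line spanned by [phi]; removing the mean removes the
   coefficient at 0.  This replaces complex characters throughout. *)
Definition fiber_sum f phi a : R := \sum_(x | dot x phi == a) f x.
Definition centered f phi a : R := fiber_sum f phi a - (\sum_x f x) / q.
Definition energy f phi : R := \sum_a centered f phi a ^+ 2.

Lemma sum_fiber_sum f phi : \sum_a fiber_sum f phi a = \sum_x f x.
Proof. by rewrite [RHS](partition_big (dot^~ phi) predT). Qed.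

Lemma sum_centered f phi : \sum_a centered f phi a = 0.
Proof.
rewrite sumrB sum_fiber_sum sumr_cst divfK ?subrr //.
by rewrite gt_eqF.
Qed.

Lemma energy_ge0 f phi : 0 <= energy f phi.
Proof. by apply: sumr_ge0 => a _; exact: sqr_ge0. Qed.

(** This quadratic form confines [phi] to one kernel, which [parseval] can sum over [phi]. *)
Lemma energyE f phi : q * energy f phi =
  \sum_x \sum_y f x * f y * (q * (dot (x - y) phi == 0)%:R - 1).
Proof.
have qn0 : q != 0 by rewrite gt_eqF.
set m := \sum_x f x.
have -> : q * energy f phi = q * \sum_a fiber_sum f phi a ^+ 2 - m ^+ 2.
  rewrite /energy (eq_bigr (fun a => fiber_sum f phi a ^+ 2
    + (m ^+ 2 / q ^+ 2 - 2 * m / q * fiber_sum f phi a))); last first.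
    by move=> a _; rewrite /centered -/m; field.
  by rewrite big_split /= sumrB sumr_cst -mulr_sumr sum_fiber_sum -/m; field.
have -> : \sum_a fiber_sum f phi a ^+ 2
    = \sum_x \sum_y f x * f y * (dot (x - y) phi == 0)%:R.
  rewrite (partition_big (dot^~ phi) predT) //=; apply: eq_bigr => a _.
  rewrite expr2 /fiber_sum big_distrlr /=; apply: eq_bigr => x /eqP xa.
  rewrite [LHS]big_mkcond; apply: eq_bigr => y _.
  rewrite dotBl xa subr_eq0 eq_sym.
  by case: eqP; rewrite ?mulr1 ?mulr0.
rewrite expr2 [m * m]big_distrlr /= mulr_sumr -sumrB; apply: eq_bigr => x _.
rewrite mulr_sumr -sumrB; apply: eq_bigr => y _.
by ring.
Qed.

(** For [x != y] a fraction [1 / q] of all [phi] is orthogonal to [x - y], so the kernel of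
    [energyE] sums to zero; on the diagonal it is always [q - 1]. *)
Lemma parseval f :
  \sum_phi q * energy f phi = #|V|%:R * (q - 1) * \sum_x f x ^+ 2.
Proof.
under eq_bigr do rewrite energyE.
rewrite exchange_big mulr_sumr /=; apply: eq_bigr => x _.
rewrite exchange_big /= (bigD1 x) //= [X in _ + X]big1 ?addr0.
  rewrite -mulr_sumr (eq_bigr (fun=> q - 1)) => [|phi _].
    by rewrite sumr_cst; ring.
  by rewrite subrr /dot mul0mx mxE eqxx mulr1.
move=> y yx; rewrite -mulr_sumr; apply/eqP; rewrite mulf_eq0; apply/orP; right.
have xy0 : x - y != 0 by rewrite subr_eq0 eq_sym.
have free : row_free (x - y) by rewrite /row_free rank_rV xy0.
have card := card_annihilator (R := R) _ free.
rewrite sumrB sumr_cst mul1r -mulr_sumr card expr1 subr_eq0 mulrC; apply/eqP.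
congr (_ * _); rewrite -sum1_card natr_sum [RHS]big_mkcond /=.
apply: eq_bigr => phi _; rewrite inE dotC /dot.
have -> : (phi *m (x - y)^T == 0) = ((phi *m (x - y)^T) 0 0 == 0).
  apply/eqP/eqP => [->|h]; first by rewrite mxE.
  by apply/matrixP => i j; rewrite !ord1 h mxE.
by case: ifP.
Qed.

(** The law of [dot t phi] for uniform [t] in [T], minus the uniform law. Its l^1 norm, [bias],
    stands in for the size of the Fourier transform of [T] on the line of [phi]. *)
Definition deviation T phi b : R :=
  average T (fun t => (dot t phi == b)%:R) - q^-1.
Definition bias T phi : R := \sum_b `|deviation T phi b|.

Lemma average_dot T phi (h : F -> R) :
  average T (fun t => h (dot t phi))
  = \sum_b average T (fun t => (dot t phi == b)%:R) * h b.
Proof.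
rewrite /average mulr_suml; under [RHS]eq_bigr do rewrite -mulrA mulr_suml.
rewrite exchange_big /=; apply: eq_bigr => t _.
rewrite (bigD1 (dot t phi)) //= big1 ?addr0; first by rewrite eqxx mul1r mulrC.
by move=> b; rewrite eq_sym => /negPf ->; rewrite mul0r.
Qed.

Lemma sum_deviation T phi : T != set0 -> \sum_b deviation T phi b = 0.
Proof.
move=> T0; rewrite sumrB sumr_cst mulVf ?gt_eqF //.
have := average_dot T phi (fun=> 1); rewrite average_const //.
by under eq_bigr do rewrite mulr1; move=> <-; rewrite subrr.
Qed.

(** Smoothing correlates the centered sums with the law of [dot t phi]; subtracting the uniform law
    is harmless because centered sums add up to zero. *)
Lemma centered_smooth T f phi a : T != set0 ->
  centered (smooth T f) phi a
  = \sum_b deviation T phi b * centered f phi (a + b).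
Proof.
move=> T0; have shift_sum : \sum_b centered f phi (a + b) = 0.
  by rewrite -[RHS](sum_centered f phi) [RHS](reindex_inj (addrI a)).
under eq_bigr do rewrite mulrBl.
rewrite sumrB -[X in _ - X]mulr_sumr shift_sum mulr0 subr0.
rewrite -(average_dot T phi (fun b => centered f phi (a + b))).
rewrite /centered sum_smooth // averageB average_const //; congr (_ - _).
rewrite /fiber_sum /smooth /average -mulr_suml exchange_big /=.
congr (_ / _); apply: eq_bigr => t _.
rewrite [RHS](reindex_inj (addIr t)) /=; apply: eq_bigl => x.
by rewrite dotDl (inj_eq (addIr _)).
Qed.

(** Young's inequality for the correlation in [centered_smooth], by Cauchy-Schwarz with the absolute
    deviations as weights. *)
Lemma energy_smooth T f phi : T != set0 ->
  energy (smooth T f) phi <= bias T phi ^+ 2 * energy f phi.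
Proof.
move=> T0; pose w b := `|deviation T phi b|.
apply: (@le_trans _ _ (\sum_a (\sum_b w b) *
    \sum_b w b * centered f phi (a + b) ^+ 2)).
  apply: ler_sum => a _; rewrite centered_smooth //.
  have := @sqr_weighted_sum R F w (fun b => `|centered f phi (a + b)|)
    (fun b => normr_ge0 _).
  under [X in _ <= _ * X]eq_bigr do rewrite real_normK ?num_real //.
  apply: le_trans; rewrite -[leLHS]real_normK ?num_real //.
  rewrite ler_sqr ?nnegrE ?normr_ge0 ?sumr_ge0 //.
    apply: le_trans (ler_norm_sum _ _ _) _.
    by under eq_bigr do rewrite normrM.
  by move=> b _; rewrite mulr_ge0 ?normr_ge0.
rewrite -mulr_sumr expr2 -mulrA ler_wpM2l ?sumr_ge0 // => [b _|].
  by rewrite normr_ge0.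
rewrite exchange_big /= /bias mulr_suml; apply: ler_sum => b _.
by rewrite -mulr_sumr /energy [X in _ <= _ * X](reindex_inj (addIr b)).
Qed.

(** Translation by [U] preserves the fibres of [dot^~ phi], so smoothing by [U] keeps the centered
    sums. *)
Lemma energy_annihilated U f phi : U != set0 ->
  {in U, forall u, dot u phi = 0} ->
  energy (fun x => f x - smooth U f x) phi = 0.
Proof.
move=> U0 Uphi; rewrite /energy big1 // => a _; apply/eqP; rewrite sqrf_eq0.
have -> : centered (fun x => f x - smooth U f x) phi a
    = centered f phi a - centered (smooth U f) phi a.
  by rewrite /centered /fiber_sum !sumrB; ring.
rewrite centered_smooth // subr_eq0; apply/eqP.
have shift_sum : \sum_b centered f phi (a + b) = 0.
  by rewrite -[RHS](sum_centered f phi) [RHS](reindex_inj (addrI a)).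
under eq_bigr do rewrite mulrBl.
rewrite sumrB -[X in _ - X]mulr_sumr shift_sum mulr0 subr0.
rewrite -(average_dot U phi (fun b => centered f phi (a + b))).
rewrite (eq_average U _ (fun=> centered f phi a)) ?average_const // => u uU.
by rewrite Uphi // addr0.
Qed.

(** By Parseval it suffices to compare energies at each [phi]: either the energy vanishes, or the
    bias is at most [eta]. *)
Lemma smooth_contraction T U f (eta : R) : T != set0 -> U != set0 ->
  (forall phi, {in U, forall u, dot u phi = 0} \/ bias T phi <= eta) ->
  \sum_x smooth T (fun x => f x - smooth U f x) x ^+ 2
  <= eta ^+ 2 * \sum_x (f x - smooth U f x) ^+ 2.
Proof.
move=> T0 U0 spec; set g := fun x => f x - smooth U f x.
have VR : (0 : R) < #|V|%:R by rewrite ltr0n; apply/card_gt0P; exists 0.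
have c0 : 0 < #|V|%:R * (q - 1) by rewrite mulr_gt0 // subr_gt0 q_gt1.
rewrite -(ler_pM2l c0) mulrCA -!parseval mulr_sumr.
apply: ler_sum => phi _; rewrite mulrCA ler_pM2l //.
apply: le_trans (energy_smooth T g phi T0) _.
have [Uphi|le_eta] := spec phi; first by rewrite energy_annihilated // !mulr0.
rewrite ler_wpM2r ?energy_ge0 // ler_sqr ?nnegrE //.
  exact: sumr_ge0.
by apply: le_trans le_eta; exact: sumr_ge0.
Qed.

(** The two smoothings commute, so the part removed by [U] contracts anew at every step. *)
Lemma iter_smooth_contraction T U f (eta : R) m : T != set0 -> U != set0 ->
  (forall phi, {in U, forall u, dot u phi = 0} \/ bias T phi <= eta) ->
  \sum_x (iter m (smooth T) f x - smooth U (iter m (smooth T) f) x) ^+ 2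
  <= eta ^+ (2 * m) * \sum_x (f x - smooth U f x) ^+ 2.
Proof.
move=> T0 U0 spec; elim: m => [|m IH]; first by rewrite muln0 mul1r.
rewrite mulnS exprD -mulrA.
have := @smooth_contraction T U (iter m (smooth T) f) eta T0 U0 spec.
rewrite /= smoothB (smoothC T U) => h; apply: le_trans h _.
by rewrite ler_wpM2l ?sqr_ge0.
Qed.

(** Independent rows make the coordinates [dot x (row i Phi)] independent and uniform over the whole
    space, so the exponential moment of the test functions [s i] factors. Over [T] their means are
    the biases, and Jensen makes the same moment large; comparing the two bounds limits [r]. *)
Lemma chang r (Phi : 'M[F]_(r, n)) T (eta : R) : T != set0 ->
  row_free Phi -> 0 <= eta <= 1 ->
  (forall i, eta <= bias T (row i Phi)) ->
  expR (r%:R * eta ^+ 2 / 32) <= #|V|%:R / #|T|%:R.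
Proof.
move=> T0 Phi_free /andP[eta0 eta1] large.
pose sg i b : R := Num.sg (deviation T (row i Phi) b).
(* Centering meets the zero-sum condition of [mgf_bound] and does not change the pairing with the
   deviation; the sup bound becomes 2. *)
pose s i b : R := sg i b - (\sum_c sg i c) / q.
have s0 i : \sum_b s i b = 0.
  rewrite sumrB sumr_cst divfK ?subrr //.
  by rewrite gt_eqF.
have sg1 i b : `|sg i b| <= 1 by rewrite normr_sg; case: (_ == _).
have s2 i b : `|s i b| <= 2.
  apply: le_trans (ler_normB _ _) _; rewrite mulr2n lerD //.
  rewrite normrM normfV [X in _ / X]gtr0_norm // ler_pdivrMr // mul1r.
  apply: le_trans (ler_norm_sum _ _ _) _.
  by rewrite -sumr_const ler_sum.
have sT i : average T (fun t => s i (dot t (row i Phi))) = bias T (row i Phi).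
  rewrite (average_dot T (row i Phi) (s i)).
  rewrite (eq_bigr (fun b => `|deviation T (row i Phi) b|
     - (\sum_c sg i c) / q * deviation T (row i Phi) b + q^-1 * s i b)).
    by rewrite big_split /= sumrB -!mulr_sumr sum_deviation // s0 !mulr0 subr0 addr0.
  move=> b _; rewrite normrEsg -/(sg i b) /s /deviation; ring.
(* This maximises [u * eta - 8 * u ^+ 2], with value [eta ^+ 2 / 32]. *)
pose u := eta / 16.
have u0 : 0 <= u by rewrite divr_ge0.
pose E (z : 'rV[F]_r) : R := expR (\sum_i u * s i (z 0 i)).
have dotE x i : dot x (row i Phi) = (x *m Phi^T) 0 i.
  by rewrite /dot !mxE; apply: eq_bigr => j _; rewrite !mxE.
have tot : \sum_(x : V) E (x *m Phi^T) <= #|V|%:R * expR (r%:R * (8 * u ^+ 2)).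
  rewrite sum_linear_fiber // (card_annihilator _ Phi_free) -mulrA.
  rewrite ler_wpM2l ?ler0n //.
  have -> : \sum_z E z = \prod_(i < r) \sum_b expR (u * s i b).
    rewrite bigA_distr_bigA /=.
    rewrite (reindex (fun g : {ffun 'I_r -> F} => \row_j g j)) /=.
      apply: eq_bigr => g _; rewrite /E expR_sum; apply: eq_bigr => i _.
      by rewrite mxE.
    exists (fun z : 'rV[F]_r => [ffun j => z 0 j]) => z _.
      by apply/ffunP => j; rewrite ffunE mxE.
    by apply/rowP => j; rewrite mxE ffunE.
  rewrite expRM_natl -exprMn -[r in leRHS]card_ord -prodr_const.
  apply: ler_prod => i _; rewrite sumr_ge0 /= => [|b _]; last exact: expR_ge0.
  have := @mgf_bound R F predT (s i) 2 u (fun b _ => s2 i b).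
  rewrite (_ : 2 * (u * 2) ^+ 2 = 8 * u ^+ 2); last by ring.
  by apply=> //; rewrite ger0_norm // /u; lra.
have TR := card_gt0R (R := R) T T0.
have low : expR (r%:R * (u * eta)) <= average T (fun t => E (t *m Phi^T)).
  apply: le_trans (expR_average _ _ T0); rewrite ler_expR.
  have -> : average T (fun t => \sum_i u * s i ((t *m Phi^T) 0 i))
      = \sum_(i < r) u * bias T (row i Phi).
    rewrite /average exchange_big /= mulr_suml; apply: eq_bigr => i _.
    rewrite -sT -averageZ; congr (_ / _); apply: eq_bigr => t _.
    by rewrite dotE.
  rewrite -[X in X%:R * _]card_ord mulr_natl -sumr_const; apply: ler_sum => i _.
  by rewrite ler_wpM2l.
have up : average T (fun t => E (t *m Phi^T))
    <= #|V|%:R / #|T|%:R * expR (r%:R * (8 * u ^+ 2)).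
  rewrite /average mulrAC ler_pM2r ?invr_gt0 //; apply: le_trans tot.
  rewrite [leRHS](bigID (mem T)) /= lerDl sumr_ge0 // => t _; exact: expR_ge0.
have := le_trans low up; rewrite -ler_pdivrMr ?expR_gt0 // -expRB.
by apply: le_trans; rewrite ler_expR /u; lra.
Qed.

End Fourier.

(** * Density on translates of a subspace, and the large spectrum *)

Section DensityIncrement.
Context {R : realType}.

Lemma smooth_adjoint (V : finZmodType) (U : {set V}) (f g : V -> R) :
  (forall u, (- u \in U) = (u \in U)) ->
  \sum_x g x * smooth U f x = \sum_x smooth U g x * f x.
Proof.
move=> UN; rewrite /smooth /average.
under eq_bigr do rewrite mulrA mulr_sumr.
under [RHS]eq_bigr do rewrite mulrAC mulr_suml.
rewrite -!mulr_suml; congr (_ / _).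
rewrite exchange_big [RHS]exchange_big /=.
rewrite (reindex_inj (@oppr_inj V)) /=; apply: eq_big => [u|u _]; first exact: UN.
by rewrite (reindex_inj (addIr u)) /=; apply: eq_bigr => x _; rewrite addrK.
Qed.

(** Suppose every translate had smaller density. Splitting the mass of [A] smoothed by [U] between
    [f] and [1 - f] bounds it by [#|A|] times 7/8 lambda + (1 + lambda/8)(1 - lambda) = 1 -
    lambda^2/8 < 1. *)
Lemma increment_on_coset (V : finZmodType) (U A : {set V}) (f : V -> R)
    (lambda : R) :
  A != set0 -> U != set0 -> (forall u, (- u \in U) = (u \in U)) ->
  (forall x, 0 <= f x <= 1) -> \sum_x f x = lambda * #|V|%:R -> 0 < lambda ->
  average A (smooth U f) <= 7 / 8 * lambda ->
  exists x, #|A|%:R / #|V|%:R * (1 + lambda / 8)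
    <= #|[set u in U | x + u \in A]|%:R / #|U|%:R.
Proof.
move=> A0 U0 UN f01 sumf l0 small.
have AR := card_gt0R (R := R) A A0; have UR := card_gt0R (R := R) U U0.
have VR : (0 : R) < #|V|%:R by rewrite ltr0n; apply/card_gt0P; exists 0.
set alpha := #|A|%:R / _.
have AE : #|A|%:R = alpha * #|V|%:R by rewrite /alpha divfK // gt_eqF.
have a0 : 0 < alpha by rewrite divr_gt0.
pose w x := smooth U (fun y => (y \in A)%:R : R) x.
have wE x : w x = #|[set u in U | x + u \in A]|%:R / #|U|%:R.
  rewrite /w /smooth /average; congr (_ / _).
  rewrite -sum1_card natr_sum big_mkcond [RHS]big_mkcond /=.
  by apply: eq_bigr => u _; rewrite inE; do 2 case: (_ \in _).
have sumA (g : V -> R) : \sum_(a in A) g a = \sum_x (x \in A)%:R * g x.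
  rewrite big_mkcond; apply: eq_bigr => x _.
  by case: ifP; rewrite ?mul1r ?mul0r.
apply: contrapT => none.
have wlt x : w x <= alpha * (1 + lambda / 8).
  by rewrite leNgt; apply/negP => /ltW h; apply: none; exists x; rewrite -wE.
have sumw : \sum_x w x = #|A|%:R.
  rewrite sum_smooth // -sum1_card natr_sum [RHS]big_mkcond /=.
  by apply: eq_bigr => x _; case: (_ \in _).
have low : \sum_x w x * f x <= 7 / 8 * lambda * #|A|%:R.
  by rewrite -smooth_adjoint // -sumA -ler_pdivrMr.
have up : \sum_x w x * (1 - f x) <= alpha * (1 + lambda / 8) * ((1 - lambda) * #|V|%:R).
  have -> : (1 - lambda) * #|V|%:R = \sum_x (1 - f x).
    by rewrite sumrB sumf sumr_cst; ring.
  rewrite mulr_sumr; apply: ler_sum => x _; rewrite ler_wpM2r //.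
  by case/andP: (f01 x) => _; rewrite subr_ge0.
have tot : #|A|%:R = \sum_x w x * f x + \sum_x w x * (1 - f x).
  by rewrite -big_split /= -sumw; apply: eq_bigr => x _; ring.
have : alpha * #|V|%:R
    <= 7 / 8 * lambda * (alpha * #|V|%:R)
       + alpha * (1 + lambda / 8) * ((1 - lambda) * #|V|%:R).
  by rewrite -AE {1}tot lerD.
have av : 0 < alpha * #|V|%:R by rewrite mulr_gt0.
rewrite [leRHS](_ : _ = alpha * #|V|%:R * (1 - lambda ^+ 2 / 8)); last by field.
rewrite ler_pMr //; have := exprn_gt0 2 l0; lra.
Qed.

(** A maximal independent family inside the large spectrum spans it, so its annihilator is
    orthogonal to all of the spectrum. *)
Lemma spectrum_basis (F : finFieldType) (n : nat) (T : {set 'rV[F]_n}) (eta : R) :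
  exists (r : nat) (Phi : 'M[F]_(r, n)),
  [/\ row_free Phi, forall i, eta <= bias T (row i Phi) &
      forall phi, {in annihilator Phi, forall u, dot u phi = 0}
        \/ bias T phi <= eta].
Proof.
pose spec := [set phi : 'rV[F]_n | eta < bias T phi].
pose M : 'M[F]_(#|spec|, n) := \matrix_(i < #|spec|) enum_val i.
exists (\rank M), (rowsub (maxrankfun M) M); split.
- exact: maxrowsub_free.
- move=> i; rewrite row_rowsub rowK.
  have := enum_valP (maxrankfun M i); rewrite inE.
  exact: ltW.
move=> phi; have [in_spec|] := boolP (phi \in spec); last first.
  by rewrite inE -leNgt; right.
left=> u; rewrite inE => /eqP u0.
have /submxP[D phiD] : (phi <= rowsub (maxrankfun M) M)%MS.
  rewrite eq_maxrowsub; have -> : phi = row (enum_rank_in in_spec phi) M.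
    by rewrite rowK enum_rankK_in.
  exact: row_sub.
by rewrite /dot phiD trmx_mul mulmxA u0 mul0mx mxE.
Qed.

(** If [1 - sigma < lambda / 2], every set [a - S] contains more than half of [L], so the average
    cannot be small. The lower bound on [ln sigma^-1] later absorbs an additive constant. *)
Lemma ln_inv_ge (V : finZmodType) (A L S : {set V}) :
  A != set0 -> S != set0 ->
  average A (fun a => average S (fun s => (a - s \in L)%:R))
    < #|L|%:R / #|V|%:R / 2 :> R ->
  #|L|%:R / #|V|%:R / 2 <= ln ((#|S|%:R / #|V|%:R)^-1) :> R.
Proof.
move=> A0 S0; set lambda := #|L|%:R / _; set sigma := #|S|%:R / _ => small.
have SR := card_gt0R (R := R) S S0.
have VR : (0 : R) < #|V|%:R by rewrite ltr0n; apply/card_gt0P; exists 0.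
have s0 : 0 < sigma by rewrite divr_gt0.
have s1 : sigma <= 1 by rewrite ler_pdivrMr // mul1r ler_nat max_card.
have lnge : 1 - sigma <= ln sigma^-1.
  rewrite lnV ?posrE //; have := expR_ge1Dx (ln sigma); rewrite lnK ?posrE //; lra.
rewrite leNgt; apply/negP => lt_ln.
have : lambda / 2 <= average A (fun a => average S (fun s => (a - s \in L)%:R)).
  rewrite -[leLHS](average_const A) //; apply: ler_average => a _.
  rewrite /average ler_pdivlMr //.
  have SE : #|S|%:R = sigma * #|V|%:R by rewrite /sigma divfK // gt_eqF.
  have LE : #|L|%:R = lambda * #|V|%:R by rewrite /lambda divfK // gt_eqF.
  have cL : \sum_s (a - s \in L)%:R = #|L|%:R :> R.
    rewrite -sum1_card natr_sum [RHS]big_mkcond /=.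
    rewrite (reindex_inj (h := fun s => a - s)) /=; last first.
      by move=> s s' /addrI /oppr_inj.
    by apply: eq_bigr => s _; rewrite subKr; case: (_ \in _).
  have cS : #|V|%:R = #|S|%:R + \sum_(s in ~: S) (1 : R).
    by rewrite sumr_const -natrD cardsC.
  have : #|L|%:R <= \sum_(s in S) (a - s \in L)%:R + \sum_(s in ~: S) (1 : R).
    rewrite -cL (bigID (mem S)) /= lerD2l.
    under [leRHS]eq_bigl do rewrite inE.
    by apply: ler_sum => s _; case: (_ \in _).
  have : #|L|%:R / 2 < #|L|%:R - (1 - sigma) * #|V|%:R.
    have h : 1 - sigma < lambda / 2 by lra.
    have : (1 - sigma) * #|V|%:R < lambda / 2 * #|V|%:R by rewrite ltr_pM2r.
    by rewrite LE; lra.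
  have : lambda / 2 * #|S|%:R <= #|L|%:R / 2.
    rewrite SE LE mulrCA (_ : lambda * #|V|%:R / 2 = lambda / 2 * #|V|%:R); last by ring.
    rewrite ler_piMl // mulr_ge0 //; lra.
  have : (1 - sigma) * #|V|%:R = #|V|%:R - #|S|%:R by rewrite SE; ring.
  lra.
by rewrite leNgt small.
Qed.

End DensityIncrement.

(** * Choice of parameters and the increment in a vector space *)

Section Core.
Context {R : realType}.

(** The factor 32 comes from [chang], 1026 from [sample_count_le] and 128 from
    [threshold_inv_le]. *)
Definition codim_bound (l : nat) (lambda alpha sigma : R) : R :=
  32 * 1026 * 128 * powR lambda (- 2%:R - l%:R^-1) * powR alpha (- l%:R^-1)
  * l%:R ^+ 2 * ln (alpha^-1) * ln (sigma^-1).

Definition threshold (l : nat) (x : R) : R := powR (x / 128) (2 * l%:R)^-1.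

Lemma threshold_expn l (x : R) : (0 < l)%N -> 0 <= x ->
  threshold l x ^+ (2 * l) = x / 128.
Proof.
move=> l0 x0; have x1 : 0 <= x / 128 by rewrite divr_ge0.
rewrite -powR_mulrn ?powR_ge0 // /threshold -powRrM natrM mulVf ?powRr1 //.
by rewrite mulf_neq0 // pnatr_eq0 -lt0n.
Qed.

Lemma threshold_itv01 l (x : R) : 0 < x <= 1 -> 0 <= threshold l x <= 1.
Proof.
move=> /andP[x0 x1]; rewrite powR_ge0 /=.
have h : 0 < x / 128 <= 1 by rewrite divr_gt0 //=; lra.
rewrite -[leRHS](powRr0 (x / 128)); apply: ger_powR => //.
by rewrite invr_ge0 mulr_ge0.
Qed.

Lemma threshold_inv_le l (y z : R) : (0 < l)%N -> 0 < y -> 0 < z ->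
  (threshold l (y * z) ^+ 2)^-1
  <= 128 * powR y (- l%:R^-1) * powR z (- l%:R^-1).
Proof.
move=> l0 y0 z0; have lR : (1 : R) <= l%:R by rewrite ler1n.
have -> : threshold l (y * z) ^+ 2 = powR (y * z / 128) l%:R^-1.
  rewrite -powR_mulrn ?powR_ge0 // /threshold -powRrM; congr powR.
  by field; rewrite gt_eqF // (lt_le_trans _ lR).
have yz : 0 <= y * z by rewrite mulr_ge0 ?ltW.
have i0 : (0 : R) <= 128^-1 by rewrite invr_ge0.
rewrite (powRM _ yz i0) (powRM _ (ltW y0) (ltW z0)) !invfM !powRN.
have h : (128^-1 : R) <= powR 128^-1 l%:R^-1.
  rewrite -{1}[128^-1](powRr1) ?invr_ge0 //; apply: ger_powR.
    by rewrite invr_gt0 ltr0n invf_le1 ?ltr0n // ler1n.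
  by rewrite invf_le1 // (lt_le_trans _ lR).
rewrite mulrC -mulrA ler_pM2r ?mulr_gt0 ?invr_gt0 ?powR_gt0 //.
by rewrite -[leRHS]invrK lef_pV2 ?posrE ?powR_gt0 ?invr_gt0.
Qed.

(** Here [a] and [s] stand for the logarithms of [1 / alpha] and [1 / sigma]. Both [X] and [X * s]
    are at least 1, so 1 + s + 1024 X s is at most 1026 X s. *)
Lemma sample_count_le (a s lambda : R) (l n : nat) :
  (0 < l)%N -> 2 <= a -> lambda / 2 <= s -> 0 < lambda <= 1 ->
  n%:R <= 1 + 1024 * l%:R ^+ 2 * a / lambda ^+ 2 ->
  1 + n%:R * s <= 1026 * (l%:R ^+ 2 * a * s / lambda ^+ 2).
Proof.
move=> l0 a2 sl /andP[lam0 lam1] nle.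
have l1 : (1 : R) <= l%:R ^+ 2 by rewrite -natrX ler1n expn_gt0 l0.
have s0 : 0 < s by lra.
pose X : R := l%:R ^+ 2 * a / lambda ^+ 2.
have la : 2 <= l%:R ^+ 2 * a by nra.
have X1 : 1 <= X by rewrite ler_pdivlMr ?exprn_gt0 //; nra.
have Xs : 1 <= X * s.
  rewrite /X mulrAC ler_pdivlMr ?exprn_gt0 // mul1r.
  have l20 : 0 <= lambda / 2 by lra.
  have := ler_pM (ler0n _ 2) l20 la sl; nra.
have : n%:R * s <= (1 + 1024 * X) * s.
  by rewrite ler_pM2r // /X; move: nle; rewrite !mulrA.
rewrite (_ : l%:R ^+ 2 * a * s / lambda ^+ 2 = X * s); last by rewrite /X mulrAC.
nra.
Qed.

(** Here [tau] is the density of the almost-periods. Taking logarithms bounds [r] by [32 / eta ^+ 2]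
    times [1 + n * ln sigma^-1], where the 1 covers ln 2. *)
Lemma rank_le_codim_bound (l n r : nat) (lambda alpha sigma tau : R) :
  let eta := threshold l (lambda * alpha) in
  (0 < l)%N -> 0 < lambda <= 1 -> 0 < alpha -> alpha < expR (- 2%:R) ->
  0 < sigma -> lambda / 2 <= ln sigma^-1 ->
  n%:R <= 1 + 1024 * l%:R ^+ 2 * ln alpha^-1 / lambda ^+ 2 ->
  sigma ^+ n / 2 <= tau -> expR (r%:R * eta ^+ 2 / 32) <= tau^-1 ->
  r%:R <= codim_bound l lambda alpha sigma.
Proof.
move=> eta l0 /[dup] lam01 /andP[lam0 lam1] a0 a2 s0 ls nle tau_ge r_le.
have ln_a : 2 <= ln alpha^-1.
  rewrite lnV ?posrE // lerNr -[- 2]expRK ler_ln ?posrE ?expR_gt0 //.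
  exact: ltW.
have cnt := sample_count_le _ _ _ _ _ l0 ln_a ls lam01 nle.
have eta0 : 0 < eta ^+ 2 by rewrite exprn_gt0 // powR_gt0 // !mulr_gt0 ?invr_gt0.
have sn0 : 0 < sigma ^+ n / 2 by rewrite divr_gt0 ?exprn_gt0.
have le1 : r%:R * eta ^+ 2 / 32 <= 1 + n%:R * ln sigma^-1.
  rewrite -ler_expR; apply: le_trans r_le _.
  rewrite expRD expRM_natl lnK ?posrE ?invr_gt0 // exprVn.
  apply: (@le_trans _ _ (sigma ^+ n / 2)^-1).
    by rewrite lef_pV2 ?posrE // (lt_le_trans sn0).
  rewrite invfM invrK mulrC ler_pM2r ?invr_gt0 ?exprn_gt0 //.
  by have := @expR_ge1Dx R 1; lra.
have le2 : r%:R <= (eta ^+ 2)^-1 * (32 * (1 + n%:R * ln sigma^-1)).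
  rewrite -ler_pdivrMl ?invr_gt0 // invrK mulrC; lra.
apply: le_trans le2 _.
have t_le := threshold_inv_le l _ _ l0 lam0 a0.
set Y := 1026 * _ in cnt.
have Y0 : 0 <= 1 + n%:R * ln sigma^-1.
  by rewrite addr_ge0 // mulr_ge0 //; lra.
apply: (@le_trans _ _ (128 * powR lambda (- l%:R^-1) * powR alpha (- l%:R^-1)
    * (32 * Y))).
  by apply: ler_pM => //; [rewrite invr_ge0 ltW | rewrite mulr_ge0 | rewrite ler_pM2l].
have lam_neq0 : (- 2%:R - l%:R^-1 == 0 :> R) ==> (lambda != 0).
  by rewrite (gt_eqF lam0) implybT.
rewrite /codim_bound /Y (powRD lam_neq0) [powR lambda (- 2)]powRN.
rewrite powR_mulrn ?(ltW lam0) //.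
set p := powR _ _; set p' := powR _ _; set la := lambda ^+ 2.
rewrite le_eqVlt; apply/orP; left; apply/eqP; ring.
Qed.

(** Pointwise, [|g|] is at most g^2 / (2c) + c / 2. *)
Lemma average_normr_le (T : finType) (A : {set T}) (g : T -> R) (c : R) :
  0 < c -> A != set0 -> \sum_x g x ^+ 2 <= c ^+ 2 * #|A|%:R ->
  average A (fun x => `|g x|) <= c.
Proof.
move=> c0 A0 h; have AR := card_gt0R (R := R) A A0.
have sq : average A (fun x => g x ^+ 2) <= c ^+ 2.
  rewrite /average ler_pdivrMr //; apply: le_trans h.
  by rewrite [leRHS](bigID (mem A)) /= lerDl sumr_ge0 // => x _; exact: sqr_ge0.
apply: (@le_trans _ _ (average A (fun x => (2 * c)^-1 * g x ^+ 2 + c / 2))).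
  apply: ler_average => x _.
  rewrite -(ler_pM2l (_ : 0 < 2 * c)) ?mulr_gt0 // mulrDr mulVKf; last first.
    by rewrite gt_eqF ?mulr_gt0.
  rewrite -[g x ^+ 2]real_normK ?num_real //.
  have := sqr_ge0 (`|g x| - c); nra.
rewrite averageD average_const // averageZ.
have : (2 * c)^-1 * average A (fun x => g x ^+ 2) <= (2 * c)^-1 * c ^+ 2.
  by rewrite ler_pM2l ?invr_gt0 ?mulr_gt0.
rewrite (_ : (2 * c)^-1 * c ^+ 2 = c / 2); last by field; rewrite gt_eqF.
by set z := _^-1 * _; lra.
Qed.

Lemma density_increment (F : finFieldType) (d l : nat)
    (A L S : {set 'rV[F]_d}) :
  (0 < l)%N -> A != set0 -> L != set0 -> S != set0 ->
  let alpha : R := #|A|%:R / #|'rV[F]_d|%:R in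
  let lambda : R := #|L|%:R / #|'rV[F]_d|%:R in
  let sigma : R := #|S|%:R / #|'rV[F]_d|%:R in
  alpha < expR (- 2%:R) ->
  average A (fun a => average S (fun s => (a - s \in L)%:R)) < lambda / 2 ->
  exists (r : nat) (Phi : 'M[F]_(r, d)),
  [/\ row_free Phi, r%:R <= codim_bound l lambda alpha sigma &
      exists x, alpha * (1 + lambda / 8)
        <= #|[set u in annihilator Phi | x + u \in A]|%:R
           / #|annihilator Phi|%:R].
Proof.
move=> l0 A0 L0 S0 alpha lambda sigma alpha2 small.
have AR := card_gt0R (R := R) A A0; have LR := card_gt0R (R := R) L L0.
have SR := card_gt0R (R := R) S S0.
have VR : (0 : R) < #|'rV[F]_d|%:R by rewrite ltr0n; apply/card_gt0P; exists 0.
have lR : (1 : R) <= l%:R by rewrite ler1n.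
have a0 : 0 < alpha by rewrite divr_gt0.
have lam0 : 0 < lambda by rewrite divr_gt0.
have sig0 : 0 < sigma by rewrite divr_gt0.
have lam1 : lambda <= 1 by rewrite ler_pdivrMr // mul1r ler_nat max_card.
have a1 : alpha <= 1 by rewrite ler_pdivrMr // mul1r ler_nat max_card.
have ln_a : 2 <= ln alpha^-1.
  rewrite lnV ?posrE // lerNr -[- 2]expRK ler_ln ?posrE ?expR_gt0 //.
  exact: ltW.
(* Each of the [l] smoothing steps costs [2 * e], so together they cost [lambda / 4]. *)
pose e : R := lambda / (8 * l%:R).
have l8 : 0 < 8 * l%:R :> R by rewrite mulr_gt0 // (lt_le_trans _ lR).
have e0 : 0 < e by rewrite divr_gt0.
have e1 : e <= 1 by rewrite ler_pdivrMr //; lra.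
(* With [n > x0], the exponent [n * e ^+ 2 / 8] exceeds [2 * ln alpha^-1], which covers the factor 4
   because [4 <= expR 2 <= alpha^-1]. *)
pose x0 : R := 16 * ln alpha^-1 / e ^+ 2.
have lna0 : 0 <= ln alpha^-1 by lra.
have x00 : 0 <= x0 by rewrite divr_ge0 ?sqr_ge0 ?mulr_ge0.
pose n := (Num.truncn x0).+1.
have /andP[n_le n_ge] := truncn_itv x00.
pose f x : R := (x \in L)%:R.
have f01 x : 0 <= f x <= 1 by rewrite /f; case: (_ \in _); rewrite lexx ler01.
have ne : 4 * #|'rV[F]_d|%:R / #|A|%:R <= expR (n%:R * e ^+ 2 / 8).
  have -> : 4 * #|'rV[F]_d|%:R / #|A|%:R = 4 * alpha^-1 by rewrite /alpha invf_div mulrA.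
  have ex2 : 4 <= expR (ln alpha^-1).
    apply: (@le_trans _ _ (expR 2)); last by rewrite ler_expR.
    rewrite (_ : 2 = 1 + 1) // expRD; have := @expR_ge1Dx R 1; nra.
  apply: (@le_trans _ _ (expR (2 * ln alpha^-1))).
    rewrite (_ : 2 * ln alpha^-1 = ln alpha^-1 + ln alpha^-1); last by ring.
    rewrite expRD -{1}[alpha^-1]lnK ?posrE ?invr_gt0 //.
    by rewrite ler_pM2r ?expR_gt0.
  rewrite ler_expR ler_pdivlMr // mulrAC.
  rewrite -ler_pdivrMr ?exprn_gt0 //; apply: le_trans (ltW n_ge).
  by rewrite /x0 ler_pM2r ?invr_gt0 ?exprn_gt0 //; lra.
have e01 : 0 < e <= 1 by rewrite e0.
have dens := almost_periods_density f A S n e f01 A0 S0 (ltn0Sn _) e01 ne.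
pose G x := average S (fun s => f (x - s)).
set T := [set t | _] in dens.
have T0 : T != set0.
  apply/set0Pn; exists 0; rewrite inE; apply/forallP => y.
  by rewrite addr0 subrr normr0 mulr_ge0 // ltW.
pose eta := threshold l (lambda * alpha).
have eta01 : 0 <= eta <= 1.
  by apply: threshold_itv01; rewrite mulr_gt0 //= mulr_ile1 // ltW.
have [r [Phi [free large spec]]] := spectrum_basis F d T eta.
exists r, Phi; split => //.
  apply: (@rank_le_codim_bound l n r lambda alpha sigma (#|T|%:R / #|'rV[F]_d|%:R)) => //.
  - by rewrite lam0.
  - exact: (ln_inv_ge _ A).
  - rewrite /n -nat1r lerD2l; apply: le_trans n_le _.
    rewrite le_eqVlt; apply/orP; left; apply/eqP; rewrite /x0 /e.
    by field; rewrite !gt_eqF // (lt_le_trans _ lR).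
  - by rewrite invf_div; exact: (chang _ Phi T eta).
have U0 : annihilator Phi != set0.
  by apply/set0Pn; exists 0; rewrite inE mul0mx.
have G01 x : 0 <= G x <= 1.
  apply/andP; split; first by apply: average_ge0 => s _; case/andP: (f01 (x - s)).
  by apply: average_le => // s _; case/andP: (f01 (x - s)).
have sumf : \sum_x f x = #|L|%:R.
  rewrite -sum1_card natr_sum [RHS]big_mkcond /=.
  by apply: eq_bigr => x _; rewrite /f; case: (_ \in _).
have sumG : \sum_x G x = #|L|%:R.
  rewrite /G /average -mulr_suml exchange_big /=.
  rewrite (eq_bigr (fun=> #|L|%:R)); last first.
    by move=> s _; rewrite -sumf [RHS](reindex_inj (addIr (- s))).
  by rewrite sumr_const -[_ *+ #|S|]mulr_natr mulfK // gt_eqF.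
pose Gl := iter l (smooth T) G.
have LE : #|L|%:R = lambda * #|'rV[F]_d|%:R by rewrite /lambda divfK // gt_eqF.
have AE : #|A|%:R = alpha * #|'rV[F]_d|%:R by rewrite /alpha divfK // gt_eqF.
apply: (@increment_on_coset _ _ _ _ Gl) => //.
- by move=> u; rewrite !inE mulNmx oppr_eq0.
- exact: iter_smooth_itv01.
- by rewrite sum_iter_smooth // sumG.
have HE : smooth A G = (fun y => average A (fun a => G (a + y))).
  by apply/funext => y; apply: eq_average => a _; rewrite addrC.
(* Averaging over [A] is smoothing by [A] at 0, which commutes with smoothing by [T]; the bound is
   [lambda / 2 + lambda / 4]. *)
have close : average A Gl <= 3 / 4 * lambda.
  have per x : {in T, forall t, `|smooth A G (x + t) - smooth A G x| <= 2 * e}.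
    by move=> t; rewrite HE inE => /forallP /(_ x).
  have := iter_smooth_close _ l _ _ T0 per 0; rewrite iter_smoothC.
  rewrite {1}/smooth {2}/smooth.
  rewrite (eq_average A (fun a => _ (0 + a)) Gl); last by move=> a _; rewrite add0r.
  rewrite (eq_average A (fun a => G (0 + a)) G); last by move=> a _; rewrite add0r.
  rewrite (_ : l%:R * (2 * e) = lambda / 4); last first.
    by rewrite /e; field; rewrite gt_eqF // (lt_le_trans _ lR).
  rewrite ler_norml => /andP[_ h].
  have smallG : average A G < lambda / 2 by exact: small.
  by clear - h smallG; lra.
(* Here [eta ^+ (2 * l)] times [2 * #|L|] equals [(lambda / 8) ^+ 2 * #|A|]. Together with [close]
   this gives the 7/8 of [increment_on_coset]. *)
have err : average A (fun x => `|Gl x - smooth (annihilator Phi) Gl x|) <= lambda / 8.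
  apply: average_normr_le => //; first by rewrite divr_gt0.
  apply: le_trans (iter_smooth_contraction _ _ G _ l T0 U0 spec) _.
  have la0 : 0 <= lambda * alpha by rewrite mulr_ge0 // ltW.
  rewrite /eta threshold_expn //.
  have : \sum_x (G x - smooth (annihilator Phi) G x) ^+ 2 <= 2 * #|L|%:R.
    have -> : 2 * #|L|%:R = \sum_x G x + \sum_x smooth (annihilator Phi) G x.
      by rewrite sum_smooth // sumG; ring.
    rewrite -big_split /=; apply: ler_sum => x _.
    have /andP[g0 g1] := G01 x; have /andP[h0 h1] := smooth_itv01 _ _ U0 G01 x.
    by move: (G x) (smooth _ G x) g0 g1 h0 h1; clear => g h *; nra.
  have c0 : 0 <= lambda * alpha / 128 by rewrite divr_ge0.
  move=> /(ler_wpM2l c0) h; apply: le_trans h _; rewrite LE AE.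
  by rewrite le_eqVlt; apply/orP; left; apply/eqP; field.
have := normr_average A (fun x => Gl x - smooth (annihilator Phi) Gl x).
rewrite averageB => h; have := le_trans h err; rewrite ler_norml => /andP[low _].
by clear - low close; lra.
Qed.

End Core.

(** * Bohr sets as subspaces of coefficient vectors *)

Section BohrSubspace.
Variables (F : finFieldType) (N : nat).
Implicit Types (x : {poly_N F}) (a : int -> F) (B : bohr F).

(** Represents, as a linear functional of [x], the coefficient [i] of the product of [x] and [a]. *)
Definition frequency_col a (i : int) : 'cV[F]_N := \col_j a (i - (j : nat)%:Z).

Lemma coef_npoly_rV x (j : 'I_N) : npoly_rV x 0 j = (val x)`_j.
Proof. by rewrite mxE. Qed.

Lemma npoly_rVD x y : npoly_rV (x + y) = npoly_rV x + npoly_rV y.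
Proof. exact: raddfD. Qed.

Lemma rVnpolyD (u v : 'rV[F]_N) : rVnpoly (u + v) = rVnpoly u + rVnpoly v.
Proof.
by apply: (can_inj (@npoly_rV_K F N)); rewrite npoly_rVD !rVnpolyK.
Qed.

Lemma rVnpolyB (u v : 'rV[F]_N) : rVnpoly (u - v) = rVnpoly u - rVnpoly v.
Proof. by apply/eqP; rewrite eq_sym subr_eq -rVnpolyD subrK. Qed.

Lemma laurent_mulE x a (i : int) :
  laurent_mul (val x) a i = (npoly_rV x *m frequency_col a i) 0 0.
Proof.
rewrite /laurent_mul mxE (big_ord_widen N (fun j => (val x)`_j * a (i - j%:Z))).
  rewrite big_mkcond; apply: eq_bigr => j _; rewrite coef_npoly_rV [in RHS]mxE.
  by case: ltnP => // le_j; rewrite nth_default // mul0r.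
exact: size_npoly.
Qed.

Lemma bohr_setP B x : reflect
  (forall (xi : freqs B) (i : int), - (width xi)%:Z <= i -> i < 0 ->
     npoly_rV x *m frequency_col (val xi) i = 0) (x \in bohr_set N B).
Proof.
rewrite inE; apply: (iffP (asboolP _)) => h xi i wi.
  move=> i0; have := h xi i wi; rewrite /frac_part i0 laurent_mulE => h0.
  by apply/matrixP => j k; rewrite !ord1 h0 mxE.
rewrite /frac_part; case: ifP => // i0.
by rewrite laurent_mulE h // mxE.
Qed.

(** The Bohr conditions are linear, so the row space of the matrix listing all members contains
    nothing else. *)
Lemma bohr_set_basis B : exists (d : nat) (M : 'M[F]_(d, N)),
  row_free M /\ forall u, (rVnpoly u \in bohr_set N B) = (u <= M)%MS.
Proof.
set BN := bohr_set N B.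
pose X : 'M[F]_(#|BN|, N) := \matrix_(i < #|BN|) npoly_rV (enum_val i).
exists (\rank X), (row_base X); split; first exact: row_base_free.
move=> u; rewrite eq_row_base; apply/idP/idP => [uB|/submxP[D ->]].
  rewrite -[u]rVnpolyK.
  have -> : npoly_rV (rVnpoly u) = row (enum_rank_in uB (rVnpoly u)) X.
    by rewrite rowK enum_rankK_in.
  exact: row_sub.
apply/bohr_setP => xi i wi i0; rewrite rVnpolyK -mulmxA.
rewrite (_ : X *m _ = 0) ?mulmx0 //; apply/row_matrixP => j.
rewrite row_mul rowK row0.
by have /bohr_setP := enum_valP j; apply.
Qed.

(** Each column of [Psi] becomes a series with its entries at t^-1, ..., t^-N. Width 1 asks that the
    coefficient of t^-1 in the product vanish, which is orthogonality to the column. *)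
Lemma bohr_set_refine B (r : nat) (Psi : 'M[F]_(N, r)) :
  exists B' : bohr F,
    bohr_set N B' = [set x in bohr_set N B | npoly_rV x *m Psi == 0]
    /\ (rk B' <= rk B + r)%N.
Proof.
(* [Negz k] is -(k+1), so entry [k] sits at t^-(k+1); all other coefficients are 0. *)
pose eta (j : 'I_r) (m : int) : F :=
  if m is Negz k then (if insub k is Some i then Psi i j else 0) else 0.
have eta_torus j : in_torus (eta j) by case.
have eta_col j : frequency_col (eta j) (-1) = col j Psi.
  apply/colP => i; rewrite !mxE.
  have -> : -1 - (i : nat)%:Z = Negz i by rewrite NegzE -opprD -PoszD add1n.
  by rewrite /eta insubT //= => p; congr (Psi _ _); apply: val_inj.
pose new : {fset (int -> F)} := [fset eta j | j in 'I_r]%fset.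
pose w0 (xi : int -> F) : nat := oapp (@width F B) 0%N (insub xi).
pose G : {fset (int -> F)} := (freqs B `|` new)%fset.
have G_torus xi : xi \in G -> in_torus xi.
  rewrite inE => /orP[|/imfsetP[j _ -> //]]; exact: freqs_torus.
(* A new frequency may already belong to [B]: the maximum keeps its old condition and makes the
   width at least 1. *)
pose B' := Bohr G_torus (fun xi : G => maxn (w0 (val xi)) (val xi \in new)).
have w0E (xi : freqs B) : w0 (val xi) = width xi by rewrite /w0 valK.
exists B'; split; last first.
  rewrite /rk /= (leq_trans (leq_card_fsetU _ _)) // leq_add2l.
  by apply: (leq_trans (leq_imfset_card _ _ _)); rewrite -cardE card_ord.
apply/setP => x; rewrite inE; apply/bohr_setP/andP.
  move=> h; split.
    apply/bohr_setP => xi i wi i0.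
    have xiG : val xi \in G by rewrite inE (valP xi).
    apply: (h [` xiG]%fset i) => //=.
    by apply: le_trans wi; rewrite lerN2 lez_nat w0E leq_maxl.
  apply/eqP/rowP => j; rewrite [RHS]mxE.
  have eta_new : eta j \in new by apply/imfsetP; exists j.
  have xiG : eta j \in G by rewrite inE eta_new orbT.
  have hj : npoly_rV x *m col j Psi = 0.
    rewrite -eta_col; apply: (h [` xiG]%fset (-1)) => //=.
    by rewrite lerN2 lez_nat leq_max eta_new orbT.
  have <- : (npoly_rV x *m col j Psi) 0 0 = (npoly_rV x *m Psi) 0 j.
    by rewrite !mxE; apply: eq_bigr => k _; rewrite !mxE.
  by rewrite hj mxE.
move=> [/bohr_setP xB /eqP xPsi] xi i wi i0.
(* An index that the old width does not reach can only be -1, at a new frequency. *)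
have [w0i|iw0] := leP (- (w0 (val xi))%:Z) i.
  move: w0i; rewrite /w0; case: insubP => [xi' _ <- /= w'|_ /= ]; first exact: xB.
  by rewrite oppr0 leNgt i0.
have [new_xi i1] : val xi \in new /\ i = -1.
  by move: wi iw0 i0 => /=; case: (_ \in new) => /=; lia.
rewrite i1; case/imfsetP: new_xi => j _ ->.
rewrite eta_col; apply/rowP => k; rewrite !ord1.
have -> : (npoly_rV x *m col j Psi) 0 0 = (npoly_rV x *m Psi) 0 j.
  by rewrite !mxE; apply: eq_bigr => k' _; rewrite !mxE.
by rewrite xPsi !mxE.
Qed.

End BohrSubspace.

(** * Convolution over a subgroup and reduction to one set *)

Section Convolution.
Variables (R : realType) (F : finFieldType) (N : nat) (H : {set {poly_N F}}).
Hypothesis H0 : 0 \in H.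
Hypothesis HB : {in H &, forall x y, x - y \in H}.
Implicit Types (f g h : {poly_N F} -> R) (x y : {poly_N F}).

Let HN x : x \in H -> - x \in H.
Proof. by move=> xH; rewrite -sub0r HB. Qed.

Let HD x y : x \in H -> y \in H -> x + y \in H.
Proof. by move=> xH yH; rewrite -[y]opprK HB // HN. Qed.

Lemma expect_shift f x : x \in H -> expect H (fun s => f (s + x)) = expect H f.
Proof.
move=> xH; rewrite /expect; congr (_ / _).
rewrite [RHS](reindex_inj (addIr x)) /=; apply: eq_bigl => s.
by apply/idP/idP => sH; [exact: HD | rewrite -(addrK x s) HB].
Qed.

Lemma expect_reflect f x : x \in H -> expect H (fun s => f (x - s)) = expect H f.
Proof.
move=> xH; rewrite /expect; congr (_ / _).
have inj : injective (fun s => x - s) by move=> s s' /addrI /oppr_inj.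
rewrite [RHS](reindex_inj inj) /=; apply: eq_bigl => s.
by apply/idP/idP => sH; [exact: HB | rewrite -(subKr x s) HB].
Qed.

Lemma eq_expect f g : {in H, f =1 g} -> expect H f = expect H g.
Proof. by move=> fg; congr (_ / _); apply: eq_bigr. Qed.

Lemma expectZl (c : R) f : expect H (fun x => c * f x) = c * expect H f.
Proof. by rewrite /expect -mulr_sumr mulrA. Qed.

Lemma expectZr (c : R) f : expect H (fun x => f x * c) = expect H f * c.
Proof. by rewrite /expect -mulr_suml mulrAC. Qed.

Lemma ler_expect f g : {in H, forall x, f x <= g x} -> expect H f <= expect H g.
Proof. by move=> fg; rewrite ler_wpM2r ?invr_ge0 ?ler0n // ler_sum. Qed.

Lemma exchange_expect (f : {poly_N F} -> {poly_N F} -> R) :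
  expect H (fun x => expect H (f x)) = expect H (fun y => expect H (f^~ y)).
Proof. by rewrite /expect -!mulr_suml exchange_big. Qed.

Lemma expect_indicator (X : {set {poly_N F}}) :
  expect H (indicator R X) = density R H X.
Proof.
rewrite /expect /density /indicator; congr (_ / _).
rewrite -sum1_card natr_sum big_mkcond [RHS]big_mkcond /=.
by apply: eq_bigr => x _; rewrite inE andbC; do 2 case: (_ \in _).
Qed.

Lemma convE f g x : x \in H -> conv H f g x = expect H (fun s => f (x - s) * g s).
Proof.
move=> xH; rewrite /conv -(expect_reflect _ _ xH); apply: eq_expect => s _.
by rewrite subKr.
Qed.

Lemma convAC f g h x : x \in H ->
  conv H (conv H f g) h x = conv H (conv H f h) g x.
Proof.
move=> xH; have E f1 f2 f3 : conv H (conv H f1 f2) f3 x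
    = expect H (fun t => expect H (fun s => f1 (x - t - s) * f2 s * f3 t)).
  rewrite convE //; apply: eq_expect => t tH.
  by rewrite convE ?HB // -expectZr.
rewrite !E exchange_expect; apply: eq_expect => t _; apply: eq_expect => s _.
by rewrite addrAC mulrAC.
Qed.

(** Moving [g] last and shifting the outer variable by [s] turns convolution with [g] into an
    average over translates of [k]. *)
Lemma inner_convAC f g h (k : {poly_N F} -> R) y : y \in H ->
  inner H (conv H (conv H f g) h) (fun x => k (x + y))
  = expect H (fun s => g s * inner H (conv H f h) (fun x => k (x + (s + y)))).
Proof.
move=> yH; rewrite /inner.
transitivity (expect H (fun x =>
    expect H (fun s => g s * (conv H f h (x - s) * k (x + y))))).
  apply: eq_expect => x xH; rewrite convAC // convE // -expectZr.
  by apply: eq_expect => s _; ring.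
rewrite exchange_expect; apply: eq_expect => s sH; rewrite expectZl; congr (_ * _).
rewrite -[LHS](expect_shift _ s) //; apply: eq_expect => x _.
by rewrite addrK addrA.
Qed.

Lemma iter_convS (L : {set {poly_N F}}) (S : nat -> {set {poly_N F}}) k :
  iter_conv R H L S k.+1 = conv H (iter_conv R H L S k) (indicator R (S k.+1)).
Proof. by rewrite /iter_conv -[X in iota _ X]addn1 iotaD foldl_cat /= add1n. Qed.

(** Induction on the number of sets, uniformly in the translate [y]: removing a set contributes its
    density and shifts [A] within [H]. *)
Lemma inner_iter_conv_ge (L A : {set {poly_N F}}) (S : nat -> {set {poly_N F}})
    (k : nat) (c : R) :
  (forall y, y \in H -> c <= inner H (conv H (indicator R L) (indicator R (S k.+1)))
     (fun x => indicator R A (x + y))) ->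
  (\prod_(1 <= i < k.+1) density R H (S i)) * c
  <= inner H (iter_conv R H L S k.+1) (indicator R A).
Proof.
move=> base; set h := indicator R (S k.+1).
have key j y : y \in H ->
    (\prod_(1 <= i < j.+1) density R H (S i)) * c
    <= inner H (conv H (iter_conv R H L S j) h) (fun x => indicator R A (x + y)).
  elim: j y => [|j IH] y yH; first by rewrite big_geq // mul1r; exact: base.
  rewrite iter_convS inner_convAC // big_nat_recr //= mulrAC mulrC.
  rewrite -expect_indicator -expectZr.
  apply: ler_expect => s sH; apply: ler_wpM2l; first by rewrite /indicator ler0n.
  by apply: IH; exact: HD.
have := key k 0 H0; rewrite -iter_convS => h1; apply: le_trans h1 _.
by apply: ler_expect => x _; rewrite addr0.
Qed.

End Convolution.

(** * Linear coordinates on a Bohr set *)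

Section Transfer.
Variables (R : realType) (F : finFieldType) (N d : nat).
Variables (M : 'M[F]_(d, N)) (H : {set {poly_N F}}).
Hypothesis M_free : row_free M.
Hypothesis HM : forall u, (rVnpoly u \in H) = (u <= M)%MS.

Definition emb (v : 'rV[F]_d) : {poly_N F} := rVnpoly (v *m M).

Lemma emb_inj : injective emb.
Proof.
move=> v w /(congr1 (@npoly_rV F N)); rewrite !rVnpolyK.
exact: row_free_inj.
Qed.

Lemma embD v w : emb (v + w) = emb v + emb w.
Proof. by rewrite /emb mulmxDl rVnpolyD. Qed.

Lemma embB v w : emb (v - w) = emb v - emb w.
Proof. by rewrite /emb mulmxBl rVnpolyB. Qed.

Lemma emb_mem v : emb v \in H.
Proof. by rewrite HM submxMl. Qed.

Lemma imset_emb : H = emb @: [set: 'rV[F]_d].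
Proof.
apply/setP => x; apply/idP/imsetP => [|[v _ ->]]; last exact: emb_mem.
rewrite -[x]npoly_rV_K HM => /submxP[v ->]; by exists v.
Qed.

Lemma sum_emb (f : {poly_N F} -> R) : \sum_(x in H) f x = \sum_v f (emb v).
Proof.
rewrite imset_emb big_imset => [|v w _ _]; last exact: emb_inj.
by apply: eq_bigl => v; rewrite inE.
Qed.

Lemma card_emb : #|H| = #|'rV[F]_d|.
Proof. by rewrite imset_emb card_imset ?cardsT //; exact: emb_inj. Qed.

Lemma card_preim_emb (X : {set {poly_N F}}) : X \subset H ->
  #|emb @^-1: X| = #|X|.
Proof.
move=> /subsetP XH; rewrite -(card_imset _ emb_inj); congr #|pred_of_set _|.
apply/setP => x; apply/imsetP/idP => [[v]|xX]; first by rewrite inE => ? ->.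
by have := XH _ xX; rewrite imset_emb => /imsetP[v _ xv]; exists v; rewrite ?inE -?xv.
Qed.

Lemma density_emb (X : {set {poly_N F}}) : X \subset H ->
  density R H X = #|emb @^-1: X|%:R / #|'rV[F]_d|%:R.
Proof.
by move=> XH; rewrite /density (setIidPl XH) card_preim_emb // card_emb.
Qed.

(** [x + y \in A] means that [x] lies in [translate A (- y)]; normalising the sums over this set and
    over [S] produces the two densities. *)
Lemma inner_conv_emb (L S A : {set {poly_N F}}) y :
  emb @^-1: S != set0 -> emb @^-1: (translate A (- y)) != set0 ->
  inner H (conv H (indicator R L) (indicator R S))
    (fun x => indicator R A (x + y))
  = #|emb @^-1: (translate A (- y))|%:R / #|'rV[F]_d|%:R
    * (#|emb @^-1: S|%:R / #|'rV[F]_d|%:R)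
    * average (emb @^-1: (translate A (- y))) (fun a =>
        average (emb @^-1: S) (fun s => (a - s \in emb @^-1: L)%:R)).
Proof.
move=> S0 A0.
have H0 : 0 \in H by rewrite -[0](subrr (emb 0)) -embB emb_mem.
have HB : {in H &, forall x z, x - z \in H}.
  by move=> x z; rewrite imset_emb => /imsetP[v _ ->] /imsetP[w _ ->];
    rewrite -embB imset_f.
have SR := card_gt0R (R := R) _ S0; have AR := card_gt0R (R := R) _ A0.
have VR : (0 : R) < #|'rV[F]_d|%:R by rewrite ltr0n; apply/card_gt0P; exists 0.
rewrite /inner /expect sum_emb card_emb /average.
rewrite (eq_bigr (fun v => #|'rV[F]_d|%:R^-1 * ((v \in emb @^-1: translate A (- y))%:R *
   \sum_(s in emb @^-1: S) (v - s \in emb @^-1: L)%:R))); last first.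
  move=> v _; rewrite convE ?emb_mem // /expect sum_emb card_emb.
  have -> : indicator R A (emb v + y) = (v \in emb @^-1: translate A (- y))%:R.
    rewrite /indicator inE; congr (nat_of_bool _)%:R.
    apply/idP/imsetP => [vA|[a aA ->]]; last by rewrite addrNK.
    by exists (emb v + y); rewrite ?addrK.
  rewrite [in RHS]big_mkcond /=.
  have -> : \sum_s indicator R L (emb v - emb s) * indicator R S (emb s)
      = \sum_s (if s \in emb @^-1: S then (v - s \in emb @^-1: L)%:R else 0).
    apply: eq_bigr => s _; rewrite /indicator !inE embB.
    by case: (_ \in S); rewrite ?mulr1 ?mulr0.
  by ring.
rewrite -mulr_sumr -[X in _ * (_ * _) * (X / _)]mulr_suml.
rewrite [X in _ * (_ * _) * (X / _ / _)]big_mkcond /=.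
rewrite (eq_bigr (fun v => if v \in emb @^-1: translate A (- y) then
   \sum_(s in emb @^-1: S) (v - s \in emb @^-1: L)%:R else 0)); last first.
  by move=> v _; case: (_ \in _); rewrite ?mul1r ?mul0r.
by field; rewrite !gt_eqF.
Qed.

End Transfer.
Arguments emb {F N d} M v.

Theorem theorem4p2 (R : realType) (q : nat)
    (hq : exists p e : nat, [/\ prime p, (0 < e)%N & q = (p ^ e)%N])
    (k : nat) (hk : (1 <= k)%N) :
  exists C c : R, [/\ 0 < C, 0 < c &
  forall (F : finFieldType) (N : nat) (B : bohr F)
    (A L : {set {poly_N F}}) (S : nat -> {set {poly_N F}}),
    #|F| = q -> (0 < N)%N ->
    let BN := bohr_set N B in
    A \subset BN -> L \subset BN ->
    (forall i : nat, (1 <= i <= k)%N -> S i \subset BN) ->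
    A != set0 -> L != set0 ->
    (forall i : nat, (1 <= i <= k)%N -> S i != set0) ->
    let alpha : R := density R BN A in
    let lambda : R := density R BN L in
    let sigma : nat -> R := fun i => density R BN (S i) in
    alpha < expR (- 2%:R) ->
    inner BN (iter_conv R BN L S k) (indicator R A)
      >= lambda * (\prod_(1 <= i < k.+1) sigma i) * alpha / 2%:R
    \/
    forall l : nat, (0 < l)%N ->
      let bound : R := C * powR lambda (- 2%:R - l%:R^-1)
        * powR alpha (- l%:R^-1) * l%:R ^+ 2
        * ln (alpha^-1) * ln ((sigma k)^-1) in
      exists B' : bohr F,
        let BN' := bohr_set N B' in
        [/\ BN' \subset BN,
            (rk B')%:R <= (rk B)%:R + bound,
            density R BN BN' >= expR (- bound)
          & exists x : {poly_N F}, x \in BN /\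
              density R BN' (translate A x) >= alpha * (1 + c * lambda)]].
Proof.
have q1 : 1 <= q%:R :> R.
  by have [p [e [/prime_gt0 p0 _ ->]]] := hq; rewrite ler1n expn_gt0 p0.
have lnq : 0 <= ln q%:R :> R by rewrite ln_ge0.
(* The factor [1 + ln q] serves both bounds: the rank grows by at most [r], and the density is
   [expR (- (r * ln q))]. *)
exists (32 * 1026 * 128 * (1 + ln q%:R)), 8^-1; split.
- by rewrite !mulr_gt0 // ltr_pwDl.
- by rewrite invr_gt0.
move=> F N B A L S cF _ BN AB LB SB A0 L0 S0 alpha lambda sigma alpha2.
case: k hk SB S0 => // k' _ SB S0.
have [d [M [M_free HM]]] := bohr_set_basis F N B; rewrite -/BN in HM.
have imE := imset_emb F N d M BN HM.
have memP x : x \in BN -> exists v, x = emb M v.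
  by rewrite imE => /imsetP[v _ ->]; exists v.
have H0 : 0 \in BN by rewrite -[0](subrr (emb M 0)) -embB emb_mem.
have HB : {in BN &, forall x z, x - z \in BN}.
  by move=> x z /memP[v ->] /memP[w ->]; rewrite -embB emb_mem.
set rhs := (X in X <= _ \/ _).
have [ge|lt_inner] := leP rhs (inner BN (iter_conv R BN L S k'.+1) (indicator R A)).
  by left.
right=> l l0 bound.
have kk : (1 <= k'.+1 <= k'.+1)%N by rewrite leqnn.
pose c0 := lambda * sigma k'.+1 * alpha / 2.
(* If every translate met the bound [c0], [inner_iter_conv_ge] would yield alternative (1). *)
have [y yB small] : exists2 y, y \in BN &
    inner BN (conv BN (indicator R L) (indicator R (S k'.+1)))
      (fun x => indicator R A (x + y)) < c0.
  apply: contrapT => none; move: lt_inner; rewrite ltNge => /negP; apply.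
  apply: le_trans (inner_iter_conv_ge _ _ _ _ H0 HB L A S k' c0 _).
    rewrite /rhs big_nat_recr //= /c0 -/(sigma k'.+1).
    by rewrite le_eqVlt; apply/orP; left; apply/eqP; ring.
  by move=> z zB; rewrite leNgt; apply/negP => lt_z; apply: none; exists z.
pose A1 := emb M @^-1: translate A (- y).
pose L1 := emb M @^-1: L.
pose S1 := emb M @^-1: S k'.+1.
have AyB : translate A (- y) \subset BN.
  apply/subsetP => _ /imsetP[a aA ->]; apply: HB => //.
  exact: (subsetP AB).
have cA1 : #|A1| = #|A|.
  by rewrite /A1 (card_preim_emb _ _ _ _ _ M_free HM) // card_imset //; exact: addIr.
have cL1 : #|L1| = #|L| by rewrite /L1 (card_preim_emb _ _ _ _ _ M_free HM).
have cS1 : #|S1| = #|S k'.+1|.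
  by rewrite /S1 (card_preim_emb _ _ _ _ _ M_free HM) // SB.
have A10 : A1 != set0 by rewrite -card_gt0 cA1 card_gt0.
have L10 : L1 != set0 by rewrite -card_gt0 cL1 card_gt0.
have S10 : S1 != set0 by rewrite -card_gt0 cS1 card_gt0 S0.
have alphaE : alpha = #|A1|%:R / #|'rV[F]_d|%:R.
  by rewrite /alpha (density_emb _ _ _ _ _ _ M_free HM) // cA1
    (card_preim_emb _ _ _ _ _ M_free HM).
have lambdaE : lambda = #|L1|%:R / #|'rV[F]_d|%:R.
  by rewrite /lambda (density_emb _ _ _ _ _ _ M_free HM).
have sigmaE : sigma k'.+1 = #|S1|%:R / #|'rV[F]_d|%:R.
  by rewrite /sigma (density_emb _ _ _ _ _ _ M_free HM) // SB.
have VR : (0 : R) < #|'rV[F]_d|%:R by rewrite ltr0n; apply/card_gt0P; exists 0.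
have a0 : 0 < alpha by rewrite alphaE divr_gt0 ?card_gt0R.
have s0 : 0 < sigma k'.+1 by rewrite sigmaE divr_gt0 ?card_gt0R.
have small1 : average A1 (fun a => average S1 (fun s => (a - s \in L1)%:R)) < lambda / 2.
  move: small; rewrite (inner_conv_emb _ _ _ _ _ _ M_free HM) // -/A1 -/S1 -/L1.
  rewrite -alphaE -sigmaE (_ : c0 = alpha * sigma k'.+1 * (lambda / 2)).
    by rewrite (ltr_pM2l (mulr_gt0 a0 s0)).
  by rewrite /c0; ring.
have := @density_increment R F d l A1 L1 S1 l0 A10 L10 S10.
rewrite /= -alphaE -lambdaE -sigmaE => /(_ alpha2 small1) [r [Phi [free r_le [x incr]]]].
have boundE : bound = codim_bound l lambda alpha (sigma k'.+1) * (1 + ln q%:R).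
  by rewrite /bound /codim_bound; ring.
have r0 : 0 <= codim_bound l lambda alpha (sigma k'.+1) by apply: le_trans r_le.
(* [pinvmx M] recovers [v] from [v *m M], so the new conditions say that [v] annihilates [Phi]. *)
have [B' [B'E rkB']] := bohr_set_refine F N B r (pinvmx M *m Phi^T).
have B'U : bohr_set N B' = emb M @: annihilator Phi.
  apply/setP => z; rewrite B'E inE; apply/andP/imsetP.
    move=> [/memP[v ->]]; rewrite rVnpolyK mulmxA mulmxKp // => h.
    by exists v; rewrite ?inE.
  move=> [v]; rewrite inE => v0 ->; split; first exact: emb_mem.
  by rewrite rVnpolyK mulmxA mulmxKp.
have cB' : #|bohr_set N B'| = #|annihilator Phi|.
  by rewrite B'U card_imset //; exact: (emb_inj _ _ _ _ M_free).
have B'sub : bohr_set N B' \subset BN.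
  by apply/subsetP => z; rewrite B'E inE => /andP[].
have UR : (0 : R) < #|annihilator Phi|%:R.
  by rewrite ltr0n; apply/card_gt0P; exists 0; rewrite inE mul0mx.
exists B'; split => //.
- apply: (@le_trans _ _ ((rk B)%:R + r%:R)); first by rewrite -natrD ler_nat.
  rewrite lerD2l boundE; apply: le_trans r_le _.
  by rewrite ler_peMr // lerDl.
- rewrite /density (setIidPl B'sub) cB' (card_emb _ _ _ _ _ M_free HM).
  rewrite (card_annihilator _ free) invfM mulVKf ?gt_eqF // cF.
  rewrite boundE -[q%:R in leRHS]lnK ?posrE ?(lt_le_trans ltr01) //.
  rewrite -expRM_natl -expRN ler_expR lerN2.
  apply: ler_pM => //; by rewrite lerDr.
(* This undoes the shift of [A] by [- y] and then that of the subspace by [x]. *)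
exists (- (emb M x + y)); split.
  by rewrite -sub0r HB // -[y]opprK HB ?emb_mem // -sub0r HB.
rewrite [8^-1 * _]mulrC; apply: le_trans incr _.
rewrite /density cB' ler_pM2r ?invr_gt0 // ler_nat.
rewrite -(card_imset _ (emb_inj _ _ _ _ M_free)); apply/subset_leq_card/subsetP.
move=> _ /imsetP[u + ->]; rewrite inE => /andP[uU]; rewrite inE => /imsetP[a aA E].
rewrite inE B'U imset_f // andbT; apply/imsetP; exists a => //.
move: E; rewrite embD => /eqP; rewrite -subr_eq opprK => /eqP <-.
by rewrite [emb M x + emb M u]addrC -[_ + y]addrA addrK.
Qed.
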